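(* Consider the 2D high-order accurate central DG method of degree $K\ge1$ in which the solution polynomials are replaced by their PCP-limited versions at each stage of the third-order SSP Runge–Kutta method, or at each step of the third-order SSP multi-step method. Then: (i) the resulting Runge–Kutta central DG method is physical-constraints-preserving (PCP) under the CFL type condition $$0<\frac{\Delta t}{\Delta x}+\frac{\Delta t}{\Delta y}\le\frac{\hat\omega_1\theta}{2c},\qquad\theta=\frac{\Delta t}{\tau_{\max}}\in(0,1];$$ (ii) the resulting multi-step central DG method is PCP under the CFL type condition $$0<\frac{\Delta t}{\Delta x}+\frac{\Delta t}{\Delta y}\le\frac{\hat\omega_1\theta}{2c},\qquad\theta=\frac{\Delta t}{\tau_{\max}}\in\left(0,\tfrac13\right].$$
   Context: **Equations.** Units with speed of light $c=1$; dimension $d=2$ with coordinates $(x,y)$. The equation of state is a function $e=e(p,\rho)$ of pressure $p>0$ and rest-mass density $\rho>0$; $h(p,\rho)=1+e(p,\rho)+p/\rho$. To primitive variables $(\rho,\mathbf v,p)$, $\mathbf v=(v_1,v_2)$, $|\mathbf v|<1$, $W=(1-|\mathbf v|^2)^{-1/2}$, corresponds $\mathbf U=(D,\mathbf m,E)^{\rm T}\in\mathbb R^4$, $D=\rho W$, $\mathbf m=\rho hW^2\mathbf v$, $E=\rho hW^2-p$. The admissible set $\mathcal G$ is the set of $\mathbf U$ whose primitive variables satisfy $\rho>0,p>0,e>0,|\mathbf v|<1$; that is, there is exactly one triple $(\rho,\mathbf v,p)$ with $\rho>0$, $|\mathbf v|<1$, $p>0$ satisfying the three relations, and $e(p,\rho)>0$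 for it. For $\mathbf U\in\mathcal G$, $\mathbf F_i(\mathbf U)=(Dv_i,v_i\mathbf m+p\,\mathbf e_i,m_i)^{\rm T}$, $i=1,2$, with $\mathbf e_i$ the $i$-th row of the identity matrix. Put $q(\mathbf U)=E-\sqrt{D^2+|\mathbf m|^2}$. Standing assumptions on the equation of state: $e$ is continuously differentiable on $\mathbb R^+\times\mathbb R^+$; for all $p,\rho>0$, $h\ge\sqrt{1+p^2/\rho^2}+p/\rho$ and $h\big(\frac1\rho-\frac{\partial h}{\partial p}\big)<\frac{\partial h}{\partial\rho}<0$; for every fixed $\rho>0$, $\lim_{p\to0^+}e(p,\rho)=0$, $\lim_{p\to+\infty}e(p,\rho)=+\infty$. **Meshes and spaces.** $I_{i,j}=(x_{i-\frac12},x_{i+\frac12})\times(y_{j-\frac12},y_{j+\frac12})$, $i,j\in\mathbb Z$, uniform with steps $\Delta x,\Delta y$ and centers $(x_i,y_j)$; dual cells $J_{i+\frac12,j+\frac12}=(x_i,x_{i+1})\times(y_j,y_{j+1})$ (boundary effects are disregarded). $x_{i\pm\frac14}=x_i\pm\frac{\Delta x}4$, $y_{j\pm\frac14}=y_j\pm\frac{\Delta y}4$. $\mathbf U_h^I,\mathbf U_h^J$ are piecewise polynomial vector functions of total degree at most $K$ on $\{I_{i,j}\}$, $\{J_{i+\frac12,j+\frac12}\}$. On $[x_{i\pm\frac14}-\frac{\Delta x}4,x_{i\pm\frac14}+\frac{\Delta x}4]$ and $[y_{j\pm\frac14}-\frac{\Delta y}4,y_{j\pm\frac14}+\frac{\Delta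 y}4]$: $x_{i\pm\frac14}^\beta,y_{j\pm\frac14}^\beta$ ($\beta=1,\dots,Q$) are the Gauss nodes with weights $\omega_\beta>0$, $\sum\omega_\beta=1$, $Q\ge K+1$; $\hat x_{i\pm\frac14}^\alpha,\hat y_{j\pm\frac14}^\alpha$ ($\alpha=1,\dots,L$) are the Gauss–Lobatto nodes with weights $\hat\omega_\alpha>0$, $\sum\hat\omega_\alpha=1$, $L\ge(K+3)/2$. The same notation is used with $i,j$ replaced by $i+\frac12,j+\frac12$. **Semi-discrete operator.** With a constant $\tau_{\max}>0$, $\mathscr L(\mathbf U)$ for $\mathbf U=(\mathbf U_h^I,\mathbf U_h^J)$ is the pair $(\mathbf R^I,\mathbf R^J)$ of piecewise polynomials of total degree at most $K$ on the two meshes such that for all $i,j$ and every polynomial $w$ of total degree at most $K$, $$\iint_{I_{i,j}}\mathbf R^Iw\,dx\,dy=\frac1{\tau_{\max}}\iint_{I_{i,j}}(\mathbf U_h^J-\mathbf U_h^I)w\,dx\,dy+\frac{\Delta x\Delta y}4\sum_{\alpha,\beta=1}^Q\sum_{\ell,m\in\{-1,1\}}\omega_\alpha\omega_\beta\big(\mathbf F_1(\mathbf U_h^J)\,\partial_xw+\mathbf F_2(\mathbf U_h^J)\,\partial_yw\big)(x_{i+\frac\ell4}^\alpha,y_{j+\frac m4}^\beta)$$ $$-\frac{\Delta y}2\sum_{\beta=1}^Q\sum_{m,s\in\{-1,1\}}s\,\omega_\beta\,\mathbf F_1\big(\mathbf U_h^J(x_{i+\frac s2},y_{j+\frac m4}^\beta)\big)w(x_{i+\frac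 s2},y_{j+\frac m4}^\beta)-\frac{\Delta x}2\sum_{\alpha=1}^Q\sum_{\ell,s\in\{-1,1\}}s\,\omega_\alpha\,\mathbf F_2\big(\mathbf U_h^J(x_{i+\frac\ell4}^\alpha,y_{j+\frac s2})\big)w(x_{i+\frac\ell4}^\alpha,y_{j+\frac s2}),$$ and the same identity with $I$ and $J$ exchanged and $(i,j)$ replaced by $(i+\frac12,j+\frac12)$ for $\mathbf R^J$ on $J_{i+\frac12,j+\frac12}$. **PCP limiter.** For the cell $I_{i,j}$ let $$\mathcal S_{ij}=(\hat{\mathcal S}_i^x\otimes\mathcal S_j^y)\cup(\mathcal S_i^x\otimes\hat{\mathcal S}_j^y)\cup(\mathcal S_i^x\otimes\mathcal S_j^y)$$ ($\otimes$ is the product of sets), where $\hat{\mathcal S}_i^x=\{\hat x_{i-\frac14}^\alpha\}_{\alpha=1}^L\cup\{\hat x_{i+\frac14}^\alpha\}_{\alpha=1}^L$, $\mathcal S_i^x=\{x_{i-\frac14}^\beta\}_{\beta=1}^Q\cup\{x_{i+\frac14}^\beta\}_{\beta=1}^Q$, and $\hat{\mathcal S}_j^y,\mathcal S_j^y$ are defined likewise from the $y$ nodes; analogously for dual cells. Let a cell with point set $\mathcal S$ have solution polynomial $(D,\mathbf m,E)^{\rm T}$ with average $\overline{\mathbf U}=(\overline D,\overline{\mathbf m},\overline E)^{\rm T}\in\mathcal G$, and let $\epsilon>0$ be a sufficiently small number such that $\overline D\ge\epsilon$, $q(\overline{\mathbf U})\ge\epsilon$. Step (i): with $D_{\min}=\min_{\mathcal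 S}D$, put $\hat D=\theta_1(D-\overline D)+\overline D$ with $\theta_1=(\overline D-\epsilon)/(\overline D-D_{\min})$ if $D_{\min}<\epsilon$, $\hat D=D$ otherwise; $\hat{\mathbf U}=(\hat D,\mathbf m,E)^{\rm T}$. Step (ii): with $q_{\min}=\min_{\mathcal S}q(\hat{\mathbf U})$, put $\tilde{\mathbf U}=\theta_2(\hat{\mathbf U}-\overline{\mathbf U})+\overline{\mathbf U}$ with $\theta_2=(q(\overline{\mathbf U})-\epsilon)/(q(\overline{\mathbf U})-q_{\min})$ if $q_{\min}<\epsilon$, $\tilde{\mathbf U}=\hat{\mathbf U}$ otherwise. The limited polynomial is $\tilde{\mathbf U}$. It is applied separately to every cell of both meshes. **Time discretization.** (Runge–Kutta) $$\mathbf U^*=\mathbf U^n+\Delta t\mathscr L(\mathbf U^n),\quad\mathbf U^{**}=\tfrac34\mathbf U^n+\tfrac14(\mathbf U^*+\Delta t\mathscr L(\mathbf U^* )),\quad\mathbf U^{n+1}=\tfrac13\mathbf U^n+\tfrac23(\mathbf U^{**}+\Delta t\mathscr L(\mathbf U^{**})).$$ (Multi-step) $$\mathbf U^{n+1}=\tfrac{16}{27}(\mathbf U^n+3\Delta t\mathscr L(\mathbf U^n))+\tfrac{11}{27}\big(\mathbf U^{n-3}+\tfrac{12}{11}\Delta t\mathscr L(\mathbf U^{n-3})\big).$$ In both, $\mathbf U^n,\mathbf U^*,\mathbf U^{**},\mathbf U^{n-3}$ on the right-hand sides are replaced by their limited versions. **PCP.** A method is PCP if, whenever the cell averages (on both meshes)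 of the starting data lie in $\mathcal G$ (the data at $t_0$ for the Runge–Kutta method; at the four starting levels $t_0,\dots,t_3$ for the multi-step method), the cell averages of the numerical solution at all later time levels, including intermediate Runge–Kutta stages, lie in $\mathcal G$, and the limited polynomials take values in $\mathcal G$ at all points of $\mathcal S$ in every cell. *)

(* Defs.v *)
From Stdlib Require Import Reals ZArith List ClassicalEpsilon.
From Coquelicot Require Import Coquelicot.
Open Scope R_scope.

(** * Relativistic hydrodynamics, with speed of light 1

    Equations of state take their arguments in the order [e p rho]. *)

Definition enthalpy (e : R -> R -> R) (p rho : R) : R := 1 + e p rho + p / rho.

Record eos_assumptions (e : R -> R -> R) : Prop := {
  eos_derivable_p : forall p rho, 0 < p -> 0 < rho ->
    ex_derive (fun t => e t rho) p;
  eos_derivable_rho : forall p rho, 0 < p -> 0 < rho ->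
    ex_derive (fun r => e p r) rho;
  eos_C1_p : forall p rho, 0 < p -> 0 < rho ->
    continuity_2d_pt (fun p' rho' => Derive (fun t => e t rho') p') p rho;
  eos_C1_rho : forall p rho, 0 < p -> 0 < rho ->
    continuity_2d_pt (fun p' rho' => Derive (fun r => e p' r) rho') p rho;
  eos_enthalpy_bound : forall p rho, 0 < p -> 0 < rho ->
    sqrt (1 + p ^ 2 / rho ^ 2) + p / rho <= enthalpy e p rho;
  eos_enthalpy_derivatives : forall p rho, 0 < p -> 0 < rho ->
    enthalpy e p rho * (1 / rho - Derive (fun t => enthalpy e t rho) p)
      < Derive (fun r => enthalpy e p r) rho < 0;
  eos_lim_0 : forall rho, 0 < rho ->
    filterlim (fun p => e p rho) (at_right 0) (locally 0);
  eos_lim_infty : forall rho, 0 < rho ->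
    is_lim (fun p => e p rho) p_infty p_infty
}.

Inductive component : Set := cD | cM1 | cM2 | cE.

Definition state : Type := component -> R.

Definition mkstate (D m1 m2 E : R) : state :=
  fun k => match k with cD => D | cM1 => m1 | cM2 => m2 | cE => E end.

Definition norm2d (a b : R) : R := sqrt (a ^ 2 + b ^ 2).

Record primitive : Type :=
  mkprim { density : R; vel1 : R; vel2 : R; pressure : R }.

Definition lorentz (w : primitive) : R :=
  / sqrt (1 - norm2d (vel1 w) (vel2 w) ^ 2).

Definition conservative (e : R -> R -> R) (w : primitive) : state :=
  let W := lorentz w in
  let rhohW2 := density w * enthalpy e (pressure w) (density w) * W ^ 2 in
  mkstate (density w * W) (rhohW2 * vel1 w) (rhohW2 * vel2 w)
          (rhohW2 - pressure w).

Definition is_primitive (e : R -> R -> R) (U : state) (w : primitive) : Prop :=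
  0 < density w /\ norm2d (vel1 w) (vel2 w) < 1 /\ 0 < pressure w /\
  forall k, U k = conservative e w k.

Definition admissible (e : R -> R -> R) (U : state) : Prop :=
  exists w, unique (is_primitive e U) w /\ 0 < e (pressure w) (density w).

(** Arbitrary when [U] has no primitive variables. *)
Definition primitive_of (e : R -> R -> R) (U : state) : primitive :=
  epsilon (inhabits (mkprim 0 0 0 0)) (is_primitive e U).

Definition flux1 (e : R -> R -> R) (U : state) : state :=
  let w := primitive_of e U in
  mkstate (U cD * vel1 w) (vel1 w * U cM1 + pressure w) (vel1 w * U cM2) (U cM1).

Definition flux2 (e : R -> R -> R) (U : state) : state :=
  let w := primitive_of e U in
  mkstate (U cD * vel2 w) (vel2 w * U cM1) (vel2 w * U cM2 + pressure w) (U cM2).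

Definition qfun (U : state) : R :=
  U cE - sqrt (U cD ^ 2 + norm2d (U cM1) (U cM2) ^ 2).

(** * Polynomials and quadrature rules *)

Definition is_poly1 (n : nat) (f : R -> R) : Prop :=
  exists a : nat -> R, forall x, f x = sum_n (fun i => a i * x ^ i) n.

(** Total degree at most [n]. *)
Definition is_poly2 (n : nat) (f : R -> R -> R) : Prop :=
  exists a : nat -> nat -> R, forall x y,
    f x y = sum_n (fun i => sum_n (fun j => a i j * x ^ i * y ^ j) (n - i)) n.

(** Nodes on [[-1,1]] and weights are indexed from 1 to [n]; weights are
    normalised to have sum 1, so that rules compute mean values. *)
Definition exact_to_degree (deg n : nat) (node weight : nat -> R) : Prop :=
  forall f, is_poly1 deg f ->
    sum_n_m (fun a => weight a * f (node a)) 1 n = RInt f (-1) 1 / 2.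

Record gauss_rule (n : nat) (node weight : nat -> R) : Prop := {
  gauss_inside : forall a, (1 <= a <= n)%nat -> -1 < node a < 1;
  gauss_increasing : forall a b, (1 <= a < b)%nat -> (b <= n)%nat ->
    node a < node b;
  gauss_weight_pos : forall a, (1 <= a <= n)%nat -> 0 < weight a;
  gauss_weight_sum : sum_n_m weight 1 n = 1;
  gauss_exact : exact_to_degree (2 * n - 1) n node weight
}.

Record gauss_lobatto_rule (n : nat) (node weight : nat -> R) : Prop := {
  lobatto_first : node 1%nat = -1;
  lobatto_last : node n = 1;
  lobatto_increasing : forall a b, (1 <= a < b)%nat -> (b <= n)%nat ->
    node a < node b;
  lobatto_weight_pos : forall a, (1 <= a <= n)%nat -> 0 < weight a;
  lobatto_weight_sum : sum_n_m weight 1 n = 1;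
  lobatto_exact : exact_to_degree (2 * n - 3) n node weight
}.

(** * Overlapping meshes and piecewise polynomials *)

Record discretization : Type := {
  x0 : R; y0 : R;
  dx : R; dy : R;
  degK : nat;
  numQ : nat; gnode : nat -> R; gweight : nat -> R;
  numL : nat; lnode : nat -> R; lweight : nat -> R;
  tau_max : R
}.

Record discretization_ok (d : discretization) : Prop := {
  dx_pos : 0 < dx d;
  dy_pos : 0 < dy d;
  tau_max_pos : 0 < tau_max d;
  numQ_large : (degK d + 1 <= numQ d)%nat;
  numL_large : (degK d + 3 <= 2 * numL d)%nat;
  gauss_ok : gauss_rule (numQ d) (gnode d) (gweight d);
  lobatto_ok : gauss_lobatto_rule (numL d) (lnode d) (lweight d)
}.

Inductive mesh : Set := primal | dual.

Definition other (M : mesh) : mesh :=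
  match M with primal => dual | dual => primal end.

Definition offset (M : mesh) : R :=
  match M with primal => 0 | dual => 1 / 2 end.

(** The indices [(i, j)] stand for [I_{i,j}] on the primal mesh and for
    [J_{i+1/2,j+1/2}] on the dual mesh. *)
Definition xc (d : discretization) (M : mesh) (i : Z) : R :=
  x0 d + (IZR i + offset M) * dx d.

Definition yc (d : discretization) (M : mesh) (j : Z) : R :=
  y0 d + (IZR j + offset M) * dy d.

Definition cell_integral (d : discretization) (M : mesh) (i j : Z)
    (f : R -> R -> R) : R :=
  RInt (fun x => RInt (fun y => f x y)
                      (yc d M j - dy d / 2) (yc d M j + dy d / 2))
       (xc d M i - dx d / 2) (xc d M i + dx d / 2).

(** [U primal] is U_h^I and [U dual] is U_h^J; each cell carries its own
    polynomial, which can thus be evaluated on the closed cell. *)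
Definition field : Type := mesh -> Z -> Z -> R -> R -> state.

Definition piecewise_poly (d : discretization) (U : field) : Prop :=
  forall M i j k, is_poly2 (degK d) (fun x y => U M i j x y k).

(** The value at a point of the plane of the piecewise polynomial on mesh [M].
    [Int_part] is the floor function; the choice it makes on cell interfaces
    is never used at quadrature nodes. *)
Definition value (d : discretization) (U : field) (M : mesh) (x y : R) : state :=
  U M (Int_part ((x - x0 d) / dx d - offset M + 1 / 2))
      (Int_part ((y - y0 d) / dy d - offset M + 1 / 2)) x y.

Definition cell_average (d : discretization) (U : field) (M : mesh) (i j : Z) :
    state :=
  fun k => cell_integral d M i j (fun x y => U M i j x y k) / (dx d * dy d).

(** * Semi-discrete operator *)

Definition sum_pm (f : R -> R) : R := f (-1) + f 1.

(** Image of the reference node [xi] in the half [s] (= -1 or 1) of the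
    interval of centre [c] and length [len]. *)
Definition half_node (c len s xi : R) : R := c + s * (len / 4) + len / 4 * xi.

Definition is_L (e : R -> R -> R) (d : discretization) (U V : field) : Prop :=
  piecewise_poly d V /\
  forall (M : mesh) (i j : Z) (w : R -> R -> R) (k : component),
    is_poly2 (degK d) w ->
    let X l a := half_node (xc d M i) (dx d) l (gnode d a) in
    let Y m b := half_node (yc d M j) (dy d) m (gnode d b) in
    let Xe s := xc d M i + s * (dx d / 2) in
    let Ye s := yc d M j + s * (dy d / 2) in
    let Uo := value d U (other M) in
    cell_integral d M i j (fun x y => V M i j x y k * w x y) =
      1 / tau_max d *
        cell_integral d M i j (fun x y => (Uo x y k - U M i j x y k) * w x y)
      + dx d * dy d / 4 *
        sum_n_m (fun a => sum_n_m (fun b => sum_pm (fun l => sum_pm (fun m =>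
          gweight d a * gweight d b *
          (flux1 e (Uo (X l a) (Y m b)) k * Derive (fun t => w t (Y m b)) (X l a)
           + flux2 e (Uo (X l a) (Y m b)) k * Derive (fun t => w (X l a) t) (Y m b)))))
          1 (numQ d)) 1 (numQ d)
      - dy d / 2 *
        sum_n_m (fun b => sum_pm (fun m => sum_pm (fun s =>
          s * gweight d b *
          flux1 e (Uo (Xe s) (Y m b)) k * w (Xe s) (Y m b)))) 1 (numQ d)
      - dx d / 2 *
        sum_n_m (fun a => sum_pm (fun l => sum_pm (fun s =>
          s * gweight d a *
          flux2 e (Uo (X l a) (Ye s)) k * w (X l a) (Ye s)))) 1 (numQ d).

(** * Limiter *)

Definition nodes_1d (c len : R) (n : nat) (node : nat -> R) : list R :=
  map (fun a => half_node c len (-1) (node a)) (seq 1 n) ++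
  map (fun a => half_node c len 1 (node a)) (seq 1 n).

Definition points (d : discretization) (M : mesh) (i j : Z) : list (R * R) :=
  let Sx := nodes_1d (xc d M i) (dx d) (numQ d) (gnode d) in
  let Sy := nodes_1d (yc d M j) (dy d) (numQ d) (gnode d) in
  let Sx' := nodes_1d (xc d M i) (dx d) (numL d) (lnode d) in
  let Sy' := nodes_1d (yc d M j) (dy d) (numL d) (lnode d) in
  list_prod Sx' Sy ++ list_prod Sx Sy' ++ list_prod Sx Sy.

Definition min_over (S : list (R * R)) (f : R -> R -> R) : R :=
  match S with
  | nil => 0
  | P :: S' => fold_right (fun P' m => Rmin (f (fst P') (snd P')) m)
                          (f (fst P) (snd P)) S'
  end.

Definition limit_density (S : list (R * R)) (eps : R) (Ubar : state)
    (U : R -> R -> state) : R -> R -> state :=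
  let Dmin := min_over S (fun x y => U x y cD) in
  let theta1 := (Ubar cD - eps) / (Ubar cD - Dmin) in
  fun x y =>
    let D' := if Rlt_dec Dmin eps
              then theta1 * (U x y cD - Ubar cD) + Ubar cD
              else U x y cD in
    mkstate D' (U x y cM1) (U x y cM2) (U x y cE).

Definition limit_q (S : list (R * R)) (eps : R) (Ubar : state)
    (U : R -> R -> state) : R -> R -> state :=
  let qmin := min_over S (fun x y => qfun (U x y)) in
  let theta2 := (qfun Ubar - eps) / (qfun Ubar - qmin) in
  fun x y k =>
    if Rlt_dec qmin eps then theta2 * (U x y k - Ubar k) + Ubar k
    else U x y k.

(** The limiter parameter may differ from cell to cell. *)
Definition limited (d : discretization) (eps : mesh -> Z -> Z -> R) (U : field) :
    field :=
  fun M i j =>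
    let S := points d M i j in
    let Ubar := cell_average d U M i j in
    limit_q S (eps M i j) Ubar (limit_density S (eps M i j) Ubar (U M i j)).

(** Only cells whose average is admissible constrain the parameter:
    admissibility of the averages is not assumed. *)
Definition eps_ok (e : R -> R -> R) (d : discretization)
    (eps : mesh -> Z -> Z -> R) (U : field) : Prop :=
  forall M i j,
    0 < eps M i j /\
    (admissible e (cell_average d U M i j) ->
     eps M i j <= cell_average d U M i j cD /\
     eps M i j <= qfun (cell_average d U M i j)).

(** * Fully discrete methods

    Solutions are the unlimited polynomials; the limited versions replace them
    on the right-hand sides. *)

Record RK_solution (e : R -> R -> R) (d : discretization) (dt : R)
    (U U1 U2 : nat -> field) (eps eps1 eps2 : nat -> mesh -> Z -> Z -> R) :
    Prop := {
  RK_start : piecewise_poly d (U 0%nat);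
  RK_eps : forall n, eps_ok e d (eps n) (U n);
  RK_eps1 : forall n, eps_ok e d (eps1 n) (U1 n);
  RK_eps2 : forall n, eps_ok e d (eps2 n) (U2 n);
  RK_step : forall n,
    let V := limited d (eps n) (U n) in
    let V1 := limited d (eps1 n) (U1 n) in
    let V2 := limited d (eps2 n) (U2 n) in
    exists LV LV1 LV2,
      is_L e d V LV /\ is_L e d V1 LV1 /\ is_L e d V2 LV2 /\
      forall M i j x y k,
        U1 n M i j x y k = V M i j x y k + dt * LV M i j x y k /\
        U2 n M i j x y k = 3 / 4 * V M i j x y k +
          1 / 4 * (V1 M i j x y k + dt * LV1 M i j x y k) /\
        U (S n) M i j x y k = 1 / 3 * V M i j x y k +
          2 / 3 * (V2 M i j x y k + dt * LV2 M i j x y k)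
}.

Record MS_solution (e : R -> R -> R) (d : discretization) (dt : R)
    (U : nat -> field) (eps : nat -> mesh -> Z -> Z -> R) : Prop := {
  MS_start : forall n, (n <= 3)%nat -> piecewise_poly d (U n);
  MS_eps : forall n, eps_ok e d (eps n) (U n);
  MS_step : forall n, (3 <= n)%nat ->
    let V := limited d (eps n) (U n) in
    let V3 := limited d (eps (n - 3)%nat) (U (n - 3)%nat) in
    exists LV LV3,
      is_L e d V LV /\ is_L e d V3 LV3 /\
      forall M i j x y k,
        U (S n) M i j x y k =
          16 / 27 * (V M i j x y k + 3 * dt * LV M i j x y k) +
          11 / 27 * (V3 M i j x y k + 12 / 11 * dt * LV3 M i j x y k)
}.

Definition averages_admissible (e : R -> R -> R) (d : discretization)
    (U : field) : Prop :=
  forall M i j, admissible e (cell_average d U M i j).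

Definition limited_admissible (e : R -> R -> R) (d : discretization)
    (eps : mesh -> Z -> Z -> R) (U : field) : Prop :=
  forall M i j x y, In (x, y) (points d M i j) ->
    admissible e (limited d eps U M i j x y).

Definition RK_PCP (e : R -> R -> R) (d : discretization) (dt : R) : Prop :=
  forall U U1 U2 eps eps1 eps2,
    RK_solution e d dt U U1 U2 eps eps1 eps2 ->
    averages_admissible e d (U 0%nat) ->
    forall n,
      averages_admissible e d (U n) /\ limited_admissible e d (eps n) (U n) /\
      averages_admissible e d (U1 n) /\ limited_admissible e d (eps1 n) (U1 n) /\
      averages_admissible e d (U2 n) /\ limited_admissible e d (eps2 n) (U2 n).

Definition MS_PCP (e : R -> R -> R) (d : discretization) (dt : R) : Prop :=
  forall U eps,
    MS_solution e d dt U eps ->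
    (forall n, (n <= 3)%nat -> averages_admissible e d (U n)) ->
    forall n,
      averages_admissible e d (U n) /\ limited_admissible e d (eps n) (U n).

(* Main.v *)
Require Import Defs.
From Stdlib Require Import Reals Lra Lia ClassicalEpsilon Ranalysis5 List.
From Coquelicot Require Import Coquelicot.
Open Scope R_scope.

(** The proof rests on a description of the admissible states that does not
    mention the primitive variables: [U] is admissible if and only if [D > 0] and
    [q(U) > 0] ([admissible_iff_cone]). Given such a [U], the velocity and the
    density are functions of the pressure, and the pressure solves a scalar
    equation. Its residual is negative near 0 and positive at infinity, and its
    slope at any zero is positive because the sound speed is below the speed of
    light; so there is exactly one solution. Conversely, the lower bound on the
    enthalpy gives [q > 0].

    Since [q] is superadditive and homogeneous, [D > 0, q > 0] defines a convex
    cone, and adding to one of its members a state with [D >= 0, q >= 0] does not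
    leave it. Lax-Friedrichs splitting provides such states: for an admissible
    [U] and a sign [s], [U - s F_i(U)] satisfies [D >= 0, q >= 0]
    ([lax_friedrichs1], [lax_friedrichs2]). The inequality may be an equality,
    the speed of light being allowed as the viscosity.

    A forward Euler step acts on the cell averages by
    [(1 - theta) avg(U) + theta avg(U')] minus differences of fluxes of [U'] at the
    ends of grid lines, where [U'] is the solution on the other mesh. The average
    of [U'] over each quarter of the cell is a Gauss-Lobatto rule along the lines
    times a Gauss rule across them, and the fluxes sit exactly at the Gauss-Lobatto
    end nodes. Sharing [avg(U')] between the two directions in the ratio of
    [dt / dx] to [dt / dy], the weight of an end node covers its flux precisely
    under the CFL condition ([line_with_fluxes_in_cone], [euler_step_in_cone]);
    the other nodes make the total strictly admissible. The two end weights of the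
    rule have to be equal for this, which follows from exactness
    ([lobatto_end_weights]).

    The limiter puts the values at all these nodes in the cone
    ([limiter_in_cone]), and both time discretizations are convex combinations of
    Euler steps ([convex_combination_good]). The Runge-Kutta method uses steps of
    length [dt], whence [theta <= 1]; the multi-step method uses steps of length
    [3 dt] and [12/11 dt], whence [theta <= 1/3]. *)

(** * Recovering the primitive variables *)

Lemma norm2d_sq a b : norm2d a b ^ 2 = a ^ 2 + b ^ 2.
Proof. unfold norm2d. apply pow2_sqrt. nra. Qed.

Lemma norm2d_lt_1 a b : norm2d a b < 1 <-> a ^ 2 + b ^ 2 < 1.
Proof.
  rewrite <- norm2d_sq.
  assert (0 <= norm2d a b) by apply sqrt_pos.
  split; nra.
Qed.

(** A function whose slope is positive at each of its zeros can only cross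
    zero upwards, hence only once: between two zeros there would be a last
    point before the second one where the function is still nonnegative, and
    that point is a zero with the wrong slope. *)
Lemma zero_unique_of_positive_slope (f f' : R -> R) (a b : R) :
  a < b -> f a = 0 -> f b = 0 ->
  (forall x, a <= x <= b -> is_derive f x (f' x)) ->
  (forall x, a <= x <= b -> f x = 0 -> 0 < f' x) -> False.
Proof.
  intros Hab Ha Hb Hd Hp.
  assert (sign_near : forall x, a <= x <= b -> f x = 0 ->
    exists delta, 0 < delta /\
      (forall y, x < y < x + delta -> 0 < f y) /\
      (forall y, x - delta < y < x -> f y < 0)).
  { intros x Hx H0.
    pose proof (proj1 (is_derive_Reals _ _ _) (Hd x Hx)) as D.
    pose proof (Hp x Hx H0) as P.
    destruct (D (f' x / 2)) as [delta Hdelta]; [lra|].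
    exists delta; split; [apply cond_pos|].
    assert (K : forall y, y <> x -> Rabs (y - x) < delta ->
                0 < f y / (y - x)).
    { intros y Hy1 Hy2.
      specialize (Hdelta (y - x)). rewrite H0 in Hdelta.
      replace (x + (y - x)) with y in Hdelta by ring.
      specialize (Hdelta ltac:(lra) Hy2).
      apply Rabs_def2 in Hdelta. unfold Rminus in *.
      rewrite Ropp_0, Rplus_0_r in Hdelta. lra. }
    split; intros y Hy.
    - assert (0 < f y / (y - x)) by (apply K; [lra|]; apply Rabs_def1; lra).
      replace (f y) with (f y / (y - x) * (y - x)) by (field; lra).
      apply Rmult_lt_0_compat; lra.
    - assert (0 < f y / (y - x)) by (apply K; [lra|]; apply Rabs_def1; lra).
      replace (f y) with (- (f y / (y - x) * (x - y))) by (field; lra).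
      apply Ropp_lt_gt_0_contravar, Rmult_lt_0_compat; lra. }
  destruct (sign_near b ltac:(lra) Hb) as [db [Hdb [_ Hneg]]].
  set (b' := Rmax ((a + b) / 2) (b - db / 2)).
  assert (Hb' : a < b' < b /\ f b' < 0).
  { unfold b'. pose proof (Rmax_l ((a + b) / 2) (b - db / 2)).
    pose proof (Rmax_r ((a + b) / 2) (b - db / 2)).
    assert (Rmax ((a + b) / 2) (b - db / 2) < b) by (apply Rmax_lub_lt; lra).
    split; [lra|]. apply Hneg; lra. }
  destruct (completeness (fun x => a <= x <= b' /\ 0 <= f x)) as [z [Hub Hleast]].
  { exists b'. intros x [Hx _]. lra. }
  { exists a. lra. }
  assert (Haz : a <= z) by (apply Hub; lra).
  assert (Hzb : z <= b') by (apply Hleast; intros x [Hx _]; lra).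
  assert (Hc : continuity_pt f z).
  { apply derivable_continuous_pt.
    exists (f' z). apply is_derive_Reals, Hd. lra. }
  destruct (Rtotal_order (f z) 0) as [Hz|[Hz|Hz]].
  - destruct (Hc (- f z) ltac:(lra)) as [delta [Hdelta Hnear]].
    assert (z <= z - Rmin delta 1); [|pose proof (Rmin_pos delta 1); lra].
    apply Hleast. intros x [Hx Hfx].
    destruct (Rle_or_lt x (z - Rmin delta 1)) as [|Hlt]; [lra|exfalso].
    assert (x <= z) by (apply Hub; lra).
    pose proof (Rmin_l delta 1).
    assert (x <> z) by (intros ->; lra).
    assert (HH : Rabs (f x - f z) < - f z).
    { apply Hnear. split; [split; [exact I|lra]|].
      simpl. unfold Rdist. apply Rabs_def1; lra. }
    apply Rabs_def2 in HH. lra.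
  - destruct (sign_near z ltac:(lra) Hz) as [dz [Hdz [Hpos _]]].
    assert (z <> b') by (intros ->; lra).
    set (x := Rmin b' (z + dz / 2)).
    assert (z < x) by (apply Rmin_glb_lt; lra).
    pose proof (Rmin_l b' (z + dz / 2)). pose proof (Rmin_r b' (z + dz / 2)).
    fold x in H1, H2.
    assert (x <= z); [|lra]. apply Hub. split; [lra|].
    apply Rlt_le, Hpos. lra.
  - destruct (Hc (f z) ltac:(lra)) as [delta [Hdelta Hnear]].
    assert (z <> b') by (intros ->; lra).
    set (x := Rmin b' (z + delta / 2)).
    assert (z < x) by (apply Rmin_glb_lt; lra).
    pose proof (Rmin_l b' (z + delta / 2)). pose proof (Rmin_r b' (z + delta / 2)).
    fold x in H1, H2.
    assert (x <= z); [|lra]. apply Hub. split; [lra|].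
    assert (HH : Rabs (f x - f z) < f z).
    { apply Hnear. split; [split; [exact I|lra]|].
      simpl. unfold Rdist. apply Rabs_def1; lra. }
    apply Rabs_def2 in HH. lra.
Qed.

Section EquationOfState.

Variable e : R -> R -> R.
Hypothesis He : eos_assumptions e.

Lemma Derive_enthalpy_p p rho : 0 < p -> 0 < rho ->
  Derive (fun t => enthalpy e t rho) p = Derive (fun t => e t rho) p + 1 / rho.
Proof.
  intros Hp Hr. apply is_derive_unique. unfold enthalpy.
  pose proof (Derive_correct _ _ (eos_derivable_p e He p rho Hp Hr)) as H.
  set (l := Derive _ _) in *. clearbody l.
  apply (is_derive_plus (fun t => 1 + e t rho) (fun t => t / rho)).
  - replace l with (plus zero l) by apply plus_zero_l.
    apply (is_derive_plus (fun _ => 1)); [apply @is_derive_const|exact H].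
  - auto_derive; [exact I|field; lra].
Qed.

Lemma is_derive_enthalpy_rho p rho : 0 < p -> 0 < rho ->
  is_derive (fun r => enthalpy e p r) rho
    (Derive (fun r => e p r) rho - p / rho ^ 2).
Proof.
  intros Hp Hr. unfold enthalpy.
  pose proof (Derive_correct _ _ (eos_derivable_rho e He p rho Hp Hr)) as H.
  set (l := Derive _ _) in *. clearbody l.
  apply (is_derive_plus (fun r => 1 + e p r) (fun r => p / r) rho l
           (- (p / rho ^ 2))).
  - replace l with (plus zero l) by apply plus_zero_l.
    apply (is_derive_plus (fun _ => 1)); [apply @is_derive_const|exact H].
  - auto_derive; [lra|field; lra].
Qed.

Lemma enthalpy_nonincreasing_rho p r1 r2 : 0 < p -> 0 < r1 -> r1 <= r2 ->
  enthalpy e p r2 <= enthalpy e p r1.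
Proof.
  intros Hp Hr1 Hr.
  destruct (MVT_gen (fun r => enthalpy e p r) r1 r2
              (fun r => Derive (fun r => e p r) r - p / r ^ 2)) as [c [Hc Heq]];
    rewrite ?Rmin_left, ?Rmax_right by lra.
  - intros x Hx. apply is_derive_enthalpy_rho; lra.
  - intros x Hx. apply derivable_continuous_pt.
    eexists. apply is_derive_Reals, is_derive_enthalpy_rho; lra.
  - rewrite Rmin_left, Rmax_right in Hc by lra.
    pose proof (eos_enthalpy_derivatives e He p c Hp ltac:(lra)) as [_ H].
    assert (Hslope : Derive (fun r : R => enthalpy e p r) c =
                     Derive (fun r => e p r) c - p / c ^ 2)
      by (apply is_derive_unique, is_derive_enthalpy_rho; lra).
    rewrite Hslope in H. nra.
Qed.

(** The bound on the enthalpy in the form in which it is used: with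
    [a = p / rho], it says that [h - a] dominates [sqrt (1 + a ^ 2)]. *)
Lemma enthalpy_quadratic_bound p rho : 0 < p -> 0 < rho ->
  0 < enthalpy e p rho /\
  2 * (p / rho) * enthalpy e p rho + 1 <= enthalpy e p rho ^ 2.
Proof.
  intros Hp Hr. pose proof (eos_enthalpy_bound e He p rho Hp Hr) as H.
  replace (p ^ 2 / rho ^ 2) with ((p / rho) ^ 2) in H by (field; lra).
  assert (0 < p / rho) by (apply Rdiv_lt_0_compat; lra).
  set (a := p / rho) in *. set (h := enthalpy e p rho) in *.
  pose proof (sqrt_pos (1 + a ^ 2)).
  assert (sqrt (1 + a ^ 2) ^ 2 = 1 + a ^ 2) by (apply pow2_sqrt; nra).
  split; nra.
Qed.

Lemma internal_energy_pos p rho : 0 < p -> 0 < rho -> 0 < e p rho.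
Proof.
  intros Hp Hr. pose proof (eos_enthalpy_bound e He p rho Hp Hr) as H.
  assert (1 < sqrt (1 + p ^ 2 / rho ^ 2)).
  { rewrite <- sqrt_1 at 1. apply sqrt_lt_1; try lra.
    - assert (0 < p ^ 2 / rho ^ 2) by (apply Rdiv_lt_0_compat; nra). lra.
    - assert (0 < p ^ 2 / rho ^ 2) by (apply Rdiv_lt_0_compat; nra). lra. }
  unfold enthalpy in H. lra.
Qed.

Lemma is_derive_eos_along (r : R -> R) (p r' : R) :
  0 < p -> 0 < r p -> is_derive r p r' ->
  is_derive (fun t => e t (r t)) p
    (Derive (fun t => e t (r p)) p + Derive (fun s => e p s) (r p) * r').
Proof.
  intros Hp Hr Hd. apply is_derive_Reals.
  replace (Derive (fun t => e t (r p)) p + Derive (fun s => e p s) (r p) * r')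
    with (Derive (fun t => e t (r p)) p * 1 + Derive (fun s => e p s) (r p) * r')
    by ring.
  apply (derivable_pt_lim_comp_2d e (fun t => t) r).
  - apply filterdiff_differentiable_pt_lim.
    apply (is_derive_filterdiff e p (r p)
             (fun x y => Derive (fun t => e t y) x)).
    + apply (locally_2d_locally
        (fun x y => is_derive (fun z => e z y) x (Derive (fun t => e t y) x))).
      exists (mkposreal _ (Rmin_pos _ _ Hp Hr)). simpl. intros u v Hu Hv.
      apply Derive_correct, (eos_derivable_p e He).
      * apply Rabs_def2 in Hu. pose proof (Rmin_l p (r p)). lra.
      * apply Rabs_def2 in Hv. pose proof (Rmin_r p (r p)). lra.
    + apply Derive_correct, (eos_derivable_rho e He); assumption.
    + apply (continuity_2d_pt_filterlim (fun x y => Derive (fun t => e t y) x)).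
      apply (eos_C1_p e He); assumption.
  - apply derivable_pt_lim_id.
  - apply is_derive_Reals, Hd.
Qed.

End EquationOfState.

(** ** The scalar equation for the pressure *)

Section PressureEquation.

Variable e : R -> R -> R.
Hypothesis He : eos_assumptions e.
Variables D E Msq : R.
Hypothesis HD : 0 < D.
Hypothesis HE : 0 < E.
Hypothesis HM : 0 <= Msq.
Hypothesis Hq : D ^ 2 + Msq < E ^ 2.

(** [(E + p) / W] and [D / W], expressed through the pressure [p] alone by
    means of [v = m / (E + p)]. *)
Definition energy_over_lorentz (p : R) : R := sqrt ((E + p) ^ 2 - Msq).

Definition density_at (p : R) : R := D * energy_over_lorentz p / (E + p).

(** The relation [E + p = rho h W ^ 2], divided by [W]. *)
Definition pressure_residual (p : R) : R :=
  D * enthalpy e p (density_at p) - energy_over_lorentz p.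

Lemma energy_over_lorentz_sq p : 0 <= p ->
  energy_over_lorentz p ^ 2 = (E + p) ^ 2 - Msq.
Proof. intros Hp. apply pow2_sqrt. nra. Qed.

Lemma energy_over_lorentz_bounds p : 0 <= p ->
  0 < energy_over_lorentz p <= E + p.
Proof.
  intros Hp. pose proof (energy_over_lorentz_sq p Hp).
  assert (0 < energy_over_lorentz p) by (apply sqrt_lt_R0; nra).
  split; [assumption|]. nra.
Qed.

Lemma density_at_bounds p : 0 <= p -> 0 < density_at p <= D.
Proof.
  intros Hp. pose proof (energy_over_lorentz_bounds p Hp) as [H1 H2].
  unfold density_at. split.
  - apply Rdiv_lt_0_compat; [apply Rmult_lt_0_compat|]; lra.
  - apply Rle_div_l; [lra|]. nra.
Qed.

Lemma energy_over_lorentz_ge p : 0 <= p ->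
  energy_over_lorentz 0 <= energy_over_lorentz p.
Proof. intros Hp. apply sqrt_le_1_alt. nra. Qed.

Lemma density_at_ge p : 0 <= p -> density_at 0 <= density_at p.
Proof.
  intros Hp.
  pose proof (energy_over_lorentz_sq p Hp).
  pose proof (energy_over_lorentz_sq 0 ltac:(lra)).
  pose proof (energy_over_lorentz_bounds p Hp).
  pose proof (energy_over_lorentz_bounds 0 ltac:(lra)).
  unfold density_at. set (s := energy_over_lorentz p) in *.
  set (s0 := energy_over_lorentz 0) in *.
  assert (s0 * (E + p) <= s * E).
  { apply pow_incr_inv with 1%nat || idtac.
    apply Rsqr_incr_0_var; unfold Rsqr; [|nra].
    replace (s0 * (E + p) * (s0 * (E + p))) with (s0 ^ 2 * (E + p) ^ 2) by ring.
    replace (s * E * (s * E)) with (s ^ 2 * E ^ 2) by ring.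
    rewrite H, H0. replace (E + 0) with E by ring.
    assert (Msq * E ^ 2 <= Msq * (E + p) ^ 2) by (apply Rmult_le_compat_l; nra).
    nra. }
  rewrite Rplus_0_r.
  apply Rle_div_l; [lra|].
  replace (D * s / (E + p) * E) with (D * (s * E) / (E + p)) by (field; lra).
  apply (proj1 (Rle_div_r (D * s0) (D * (s * E)) (E + p) ltac:(lra))).
  rewrite Rmult_assoc. apply Rmult_le_compat_l; lra.
Qed.

Lemma is_derive_energy_over_lorentz p : 0 <= p ->
  is_derive energy_over_lorentz p ((E + p) / energy_over_lorentz p).
Proof.
  intros Hp. pose proof (energy_over_lorentz_bounds p Hp).
  unfold energy_over_lorentz in *. auto_derive.
  - nra.
  - replace (sqrt ((E + p) * ((E + p) * 1) + - Msq))
      with (sqrt ((E + p) ^ 2 - Msq)) by (f_equal; ring).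
    field. lra.
Qed.

Lemma is_derive_density_at p : 0 <= p ->
  is_derive density_at p
    (D * Msq / (energy_over_lorentz p * (E + p) ^ 2)).
Proof.
  intros Hp. pose proof (energy_over_lorentz_bounds p Hp).
  pose proof (energy_over_lorentz_sq p Hp) as Hs.
  pose proof (is_derive_energy_over_lorentz p Hp) as Hd.
  unfold density_at.
  set (s := energy_over_lorentz) in *.
  auto_derive.
  - split; [eexists; exact Hd|]. split; [lra|exact I].
  - replace (Derive (fun x : R => s x) p) with ((E + p) / s p)
      by (symmetry; apply is_derive_unique; exact Hd).
    replace Msq with ((E + p) ^ 2 - s p ^ 2) by lra. field. lra.
Qed.

Definition pressure_slope (p : R) : R :=
  D * (Derive (fun t => enthalpy e t (density_at p)) p
       + Derive (fun r => enthalpy e p r) (density_at p)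
         * (D * Msq / (energy_over_lorentz p * (E + p) ^ 2)))
  - (E + p) / energy_over_lorentz p.

Lemma is_derive_pressure_residual p : 0 < p ->
  is_derive pressure_residual p (pressure_slope p).
Proof.
  intros Hp.
  pose proof (energy_over_lorentz_bounds p (Rlt_le _ _ Hp)).
  pose proof (density_at_bounds p (Rlt_le _ _ Hp)).
  pose proof (is_derive_energy_over_lorentz p (Rlt_le _ _ Hp)) as Hs.
  pose proof (is_derive_density_at p (Rlt_le _ _ Hp)) as Hr.
  pose proof (is_derive_eos_along e He density_at p _ Hp (proj1 H0) Hr) as Heos.
  unfold pressure_slope.
  rewrite (Derive_enthalpy_p e He p _ Hp (proj1 H0)).
  replace (Derive (fun r : R => enthalpy e p r) (density_at p))
    with (Derive (fun r => e p r) (density_at p) - p / density_at p ^ 2)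
    by (symmetry; apply is_derive_unique, (is_derive_enthalpy_rho e He); lra).
  set (r' := D * Msq / (energy_over_lorentz p * (E + p) ^ 2)) in *.
  unfold pressure_residual, enthalpy.
  set (g := fun t => e t (density_at t)).
  change (is_derive g p (Derive (fun t => e t (density_at p)) p
    + Derive (fun s => e p s) (density_at p) * r')) in Heos.
  apply (is_derive_ext
    (fun t => D * (1 + g t + t / density_at t) - energy_over_lorentz t));
    [reflexivity|].
  set (ge := Derive (fun t => e t (density_at p)) p) in *.
  set (gr := Derive (fun s => e p s) (density_at p)) in *.
  set (rho := density_at) in *. set (s := energy_over_lorentz) in *.
  clearbody g r' ge gr. clearbody rho s.
  auto_derive.
  - repeat split; try (eexists; eassumption); lra.
  - replace (Derive (fun x : R => g x) p) with (ge + gr * r')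
      by (symmetry; apply is_derive_unique; exact Heos).
    replace (Derive (fun x : R => rho x) p) with r'
      by (symmetry; apply is_derive_unique; exact Hr).
    replace (Derive (fun x : R => s x) p) with ((E + p) / s p)
      by (symmetry; apply is_derive_unique; exact Hs).
    field. lra.
Qed.

(** At a zero the residual increases because the sound speed is below the
    speed of light: there [density_at] has slope [v ^ 2 / h] and [(E + p) / s]
    equals [D / rho], so the slope of the residual is [D] times
    [h_p - 1 / rho + h_rho v ^ 2 / h], and [h_p - 1 / rho] exceeds
    [- h_rho / h > 0]. *)
Lemma pressure_slope_pos p : 0 < p -> pressure_residual p = 0 ->
  0 < pressure_slope p.
Proof.
  intros Hp H0.
  pose proof (energy_over_lorentz_bounds p (Rlt_le _ _ Hp)) as Hs.
  pose proof (energy_over_lorentz_sq p (Rlt_le _ _ Hp)) as Hs2.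
  pose proof (density_at_bounds p (Rlt_le _ _ Hp)) as Hr.
  destruct (enthalpy_quadratic_bound e He p _ Hp (proj1 Hr)) as [Hh _].
  pose proof (eos_enthalpy_derivatives e He p _ Hp (proj1 Hr)) as [H1 H2].
  unfold pressure_slope. unfold pressure_residual in H0.
  set (hp := Derive (fun t => enthalpy e t (density_at p)) p) in *.
  set (hr := Derive (fun r => enthalpy e p r) (density_at p)) in *.
  set (h := enthalpy e p (density_at p)) in *.
  assert (Hrs : (E + p) / energy_over_lorentz p = D / density_at p).
  { unfold density_at. field. lra. }
  rewrite Hrs.
  set (s := energy_over_lorentz p) in *. set (rho := density_at p) in *.
  replace (D * Msq / (s * (E + p) ^ 2)) with (Msq / (E + p) ^ 2 / h)
    by (replace s with (D * h) by lra; field; repeat split; lra).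
  set (vsq := Msq / (E + p) ^ 2).
  assert (Hv : 0 <= vsq < 1).
  { assert (0 < (E + p) ^ 2) by nra. unfold vsq. split.
    - apply Rdiv_le_0_compat; lra.
    - apply Rlt_div_l; nra. }
  assert (K : 0 < (hp - 1 / rho) * h + hr * vsq).
  { assert (hr * vsq >= hr) by nra. nra. }
  replace (D * (hp + hr * (vsq / h)) - D / rho)
    with (D / h * ((hp - 1 / rho) * h + hr * vsq)) by (field; lra).
  apply Rmult_lt_0_compat; [apply Rdiv_lt_0_compat|]; lra.
Qed.

Lemma pressure_unique p1 p2 : 0 < p1 -> 0 < p2 ->
  pressure_residual p1 = 0 -> pressure_residual p2 = 0 -> p1 = p2.
Proof.
  assert (W : forall a b, 0 < a -> pressure_residual a = 0 ->
              pressure_residual b = 0 -> ~ a < b).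
  { intros a b Ha Za Zb Hab.
    apply (zero_unique_of_positive_slope pressure_residual pressure_slope a b
             Hab Za Zb).
    - intros x Hx. apply is_derive_pressure_residual. lra.
    - intros x Hx. apply pressure_slope_pos. lra. }
  intros H1 H2 Z1 Z2.
  destruct (Rtotal_order p1 p2) as [H|[H|H]]; [|assumption|];
    exfalso; eapply W; [| | |exact H| | | |exact H]; assumption.
Qed.

(** As [p] tends to 0, [h] tends to 1 and the residual is asymptotically at
    most [D - sqrt (E ^ 2 - |m| ^ 2) < 0]. The internal energy only has a limit
    at fixed density, so the varying density is first replaced by its smallest
    value: [h] decreases with the density. *)
Lemma pressure_residual_neg_near_0 :
  exists p, 0 < p < 1 /\ pressure_residual p < 0.
Proof.
  pose proof (density_at_bounds 0 ltac:(lra)) as Hr0.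
  pose proof (energy_over_lorentz_bounds 0 ltac:(lra)) as Hs0.
  pose proof (energy_over_lorentz_sq 0 ltac:(lra)) as Hs2.
  assert (Hgap : D < energy_over_lorentz 0) by nra.
  set (s0 := energy_over_lorentz 0) in *. set (r0 := density_at 0) in *.
  set (gap := s0 - D).
  assert (Hd : 0 < gap / (4 * D)) by (apply Rdiv_lt_0_compat; unfold gap; lra).
  destruct (eos_lim_0 e He r0 (proj1 Hr0)
              (ball 0 (mkposreal _ Hd)) (locally_ball _ _)) as [delta Hdelta].
  set (p := Rmin (delta / 2) (Rmin (1 / 2) (r0 * (gap / (4 * D))))).
  pose proof (cond_pos delta).
  assert (Hp : 0 < p).
  { repeat apply Rmin_glb_lt; try lra. apply Rmult_lt_0_compat; lra. }
  pose proof (Rmin_l (delta / 2) (Rmin (1 / 2) (r0 * (gap / (4 * D))))).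
  pose proof (Rmin_r (delta / 2) (Rmin (1 / 2) (r0 * (gap / (4 * D))))).
  pose proof (Rmin_l (1 / 2) (r0 * (gap / (4 * D)))).
  pose proof (Rmin_r (1 / 2) (r0 * (gap / (4 * D)))).
  fold p in H0, H1.
  exists p. split; [lra|].
  assert (Hsmall : e p r0 < gap / (4 * D)).
  { assert (B : ball 0 (mkposreal _ Hd) (e p r0)).
    { apply Hdelta; [|exact Hp]. apply Rabs_def1; simpl;
        unfold minus, plus, opp; simpl; lra. }
    apply Rabs_def2 in B. simpl in B. unfold minus, plus, opp in B; simpl in B.
    lra. }
  assert (Hpr : p / r0 <= gap / (4 * D)) by (apply Rle_div_l; lra).
  pose proof (enthalpy_nonincreasing_rho e He p r0 (density_at p) Hp
    (proj1 Hr0) (density_at_ge p ltac:(lra))) as Hh.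
  pose proof (energy_over_lorentz_ge p ltac:(lra)) as Hs. fold s0 in Hs.
  unfold pressure_residual.
  assert (enthalpy e p r0 <= 1 + 2 * (gap / (4 * D))) by (unfold enthalpy; lra).
  assert (D * enthalpy e p (density_at p) <= D * (1 + 2 * (gap / (4 * D))))
    by (apply Rmult_le_compat_l; lra).
  replace (D * (1 + 2 * (gap / (4 * D)))) with (D + gap / 2) in H5 by (field; lra).
  unfold gap in *. lra.
Qed.

(** As [p] grows, [h] is at least its value at the largest density [D], and the
    term [p] in [D h] compensates that of [s <= E + p]. *)
Lemma pressure_residual_pos_at_infty :
  exists p, 1 < p /\ 0 < pressure_residual p.
Proof.
  destruct (proj2 (is_lim_spec _ _ _) (eos_lim_infty e He D HD) (E / D))
    as [M HMbig].
  set (p := Rmax M 1 + 1).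
  pose proof (Rmax_l M 1). pose proof (Rmax_r M 1).
  exists p. split; [unfold p; lra|].
  assert (Hp : 0 < p) by (unfold p; lra).
  assert (Hbig : E / D < e p D) by (apply HMbig; unfold p; lra).
  pose proof (density_at_bounds p ltac:(lra)) as Hr.
  pose proof (enthalpy_nonincreasing_rho e He p (density_at p) D Hp
    (proj1 Hr) (proj2 Hr)) as Hh.
  pose proof (energy_over_lorentz_bounds p ltac:(lra)) as Hs.
  unfold pressure_residual.
  assert (D * enthalpy e p D <= D * enthalpy e p (density_at p))
    by (apply Rmult_le_compat_l; lra).
  assert (D * enthalpy e p D = D + D * e p D + p)
    by (unfold enthalpy; field; lra).
  apply Rlt_div_l in Hbig; [|exact HD]. lra.
Qed.

Lemma pressure_exists : exists p, 0 < p /\ pressure_residual p = 0.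
Proof.
  destruct pressure_residual_neg_near_0 as [p1 [H1 N]].
  destruct pressure_residual_pos_at_infty as [p2 [H2 P]].
  destruct (IVT_interv pressure_residual p1 p2) as [p [Hp Z]]; try lra.
  - intros x Hx. apply derivable_continuous_pt.
    eexists. apply is_derive_Reals, is_derive_pressure_residual. lra.
  - exists p. split; [lra|exact Z].
Qed.

End PressureEquation.

(** * The admissible states as an open convex cone *)

Definition state_add (U V : state) : state := fun k => U k + V k.

Definition state_scale (c : R) (U : state) : state := fun k => c * U k.

(** The states with [D > 0] and [q > 0], and the states with [D >= 0] and
    [q >= 0]: since [q] is superadditive and homogeneous both are convex cones,
    and the sum of a member of each is again in the first. *)
Definition open_cone (U : state) : Prop := 0 < U cD /\ 0 < qfun U.

Definition closed_cone (U : state) : Prop := 0 <= U cD /\ 0 <= qfun U.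

Lemma qfun_sq U :
  qfun U = U cE - sqrt (U cD ^ 2 + (U cM1 ^ 2 + U cM2 ^ 2)).
Proof. unfold qfun. rewrite norm2d_sq. reflexivity. Qed.

Lemma qfun_pos_iff U : 0 < qfun U <->
  0 < U cE /\ U cD ^ 2 + (U cM1 ^ 2 + U cM2 ^ 2) < U cE ^ 2.
Proof.
  rewrite qfun_sq. set (n := U cD ^ 2 + (U cM1 ^ 2 + U cM2 ^ 2)).
  assert (Hn : 0 <= n) by (unfold n; nra).
  pose proof (sqrt_pos n). pose proof (pow2_sqrt n Hn).
  split; [intros; split; nra|intros [H1 H2]; nra].
Qed.

Lemma qfun_nonneg U : 0 <= U cE ->
  U cD ^ 2 + (U cM1 ^ 2 + U cM2 ^ 2) <= U cE ^ 2 -> 0 <= qfun U.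
Proof.
  rewrite qfun_sq. set (n := U cD ^ 2 + (U cM1 ^ 2 + U cM2 ^ 2)). intros H1 H2.
  assert (Hn : 0 <= n) by (unfold n; nra).
  pose proof (sqrt_pos n). pose proof (pow2_sqrt n Hn). nra.
Qed.

Lemma qfun_ext U V : (forall k, U k = V k) -> qfun U = qfun V.
Proof. intros H. unfold qfun. now rewrite !H. Qed.

Lemma qfun_scale c U : 0 <= c -> qfun (state_scale c U) = c * qfun U.
Proof.
  intros Hc. rewrite !qfun_sq. unfold state_scale.
  set (n := U cD ^ 2 + (U cM1 ^ 2 + U cM2 ^ 2)).
  replace ((c * U cD) ^ 2 + ((c * U cM1) ^ 2 + (c * U cM2) ^ 2))
    with (c ^ 2 * n) by (unfold n; ring).
  rewrite sqrt_mult_alt, sqrt_pow2 by nra. ring.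
Qed.

(** Minkowski's inequality for [(D, m1, m2)]. *)
Lemma qfun_add U V : qfun U + qfun V <= qfun (state_add U V).
Proof.
  rewrite !qfun_sq. unfold state_add.
  set (a0 := U cD); set (a1 := U cM1); set (a2 := U cM2).
  set (b0 := V cD); set (b1 := V cM1); set (b2 := V cM2).
  set (A := a0 ^ 2 + (a1 ^ 2 + a2 ^ 2)). set (B := b0 ^ 2 + (b1 ^ 2 + b2 ^ 2)).
  assert (HA : 0 <= A) by (unfold A; nra). assert (HB : 0 <= B) by (unfold B; nra).
  set (P := a0 * b0 + a1 * b1 + a2 * b2).
  assert (CS : P ^ 2 <= A * B).
  { assert (0 <= A * B - P ^ 2); [|lra].
    replace (A * B - P ^ 2) with
      ((a0 * b1 - a1 * b0) ^ 2 + (a0 * b2 - a2 * b0) ^ 2 + (a1 * b2 - a2 * b1) ^ 2)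
      by (unfold A, B, P; ring).
    repeat apply Rplus_le_le_0_compat; apply pow2_ge_0. }
  pose proof (sqrt_pos A). pose proof (sqrt_pos B).
  pose proof (pow2_sqrt A HA). pose proof (pow2_sqrt B HB).
  assert (HP : P <= sqrt A * sqrt B).
  { rewrite <- sqrt_mult by assumption.
    apply Rle_trans with (sqrt (P ^ 2)).
    - replace (P ^ 2) with (Rsqr P) by (unfold Rsqr; ring).
      rewrite sqrt_Rsqr_abs. apply Rle_abs.
    - apply sqrt_le_1_alt, CS. }
  assert (sqrt ((a0 + b0) ^ 2 + ((a1 + b1) ^ 2 + (a2 + b2) ^ 2))
          <= sqrt A + sqrt B).
  { replace ((a0 + b0) ^ 2 + ((a1 + b1) ^ 2 + (a2 + b2) ^ 2)) with (A + B + 2 * P)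
      by (unfold A, B, P; ring).
    rewrite <- (sqrt_pow2 (sqrt A + sqrt B)) by lra.
    apply sqrt_le_1_alt. nra. }
  lra.
Qed.

Lemma open_cone_ext U V : (forall k, U k = V k) -> open_cone U -> open_cone V.
Proof.
  intros H [H1 H2]. split; [rewrite <- H|rewrite <- (qfun_ext U V H)]; assumption.
Qed.

Lemma open_cone_closed U : open_cone U -> closed_cone U.
Proof. intros [H1 H2]. split; lra. Qed.

Lemma open_cone_add U V :
  open_cone U -> closed_cone V -> open_cone (state_add U V).
Proof.
  intros [H1 H2] [H3 H4]. split.
  - unfold state_add. lra.
  - pose proof (qfun_add U V). lra.
Qed.

Lemma closed_cone_add U V :
  closed_cone U -> closed_cone V -> closed_cone (state_add U V).
Proof.
  intros [H1 H2] [H3 H4]. split.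
  - unfold state_add. lra.
  - pose proof (qfun_add U V). lra.
Qed.

Lemma open_cone_scale c U : 0 < c -> open_cone U -> open_cone (state_scale c U).
Proof.
  intros Hc [H1 H2]. split.
  - apply Rmult_lt_0_compat; assumption.
  - rewrite qfun_scale by lra. apply Rmult_lt_0_compat; assumption.
Qed.

Lemma closed_cone_scale c U :
  0 <= c -> closed_cone U -> closed_cone (state_scale c U).
Proof.
  intros Hc [H1 H2]. split.
  - apply Rmult_le_pos; assumption.
  - rewrite qfun_scale by lra. apply Rmult_le_pos; assumption.
Qed.

Lemma open_cone_sum (Z : nat -> state) n m : (n <= m)%nat ->
  (forall a, (n <= a <= m)%nat -> open_cone (Z a)) ->
  open_cone (fun k => sum_n_m (fun a => Z a k) n m).
Proof.
  intros Hnm. induction Hnm as [|m Hnm IH]; intros HZ.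
  - apply (open_cone_ext (Z n)); [|apply HZ; lia].
    intros k. now rewrite sum_n_n.
  - apply (open_cone_ext (state_add (fun k => sum_n_m (fun a => Z a k) n m) (Z (S m)))).
    + intros k. rewrite sum_n_Sm by lia. reflexivity.
    + apply open_cone_add.
      * apply IH. intros a Ha. apply HZ. lia.
      * apply open_cone_closed, HZ. lia.
Qed.

(** ** Admissibility and the cone *)

Section Admissible.

Variable e : R -> R -> R.
Hypothesis He : eos_assumptions e.

Lemma lorentz_spec w : norm2d (vel1 w) (vel2 w) < 1 ->
  0 < lorentz w /\ lorentz w ^ 2 * (1 - (vel1 w ^ 2 + vel2 w ^ 2)) = 1.
Proof.
  intros H. apply norm2d_lt_1 in H. unfold lorentz. rewrite norm2d_sq.
  set (g := 1 - (vel1 w ^ 2 + vel2 w ^ 2)).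
  assert (Hg : 0 < g) by (unfold g; lra).
  pose proof (sqrt_lt_R0 g Hg). pose proof (pow2_sqrt g (Rlt_le _ _ Hg)).
  split; [now apply Rinv_0_lt_compat|].
  rewrite pow_inv, H1. field. lra.
Qed.

(** [W ^ 2 (rho ^ 2 h ^ 2 - 2 rho h p - rho ^ 2) + p ^ 2 = E ^ 2 - D ^ 2 - |m| ^ 2],
    and the enthalpy bound makes the bracket nonnegative. *)
Lemma primitive_in_cone U w : is_primitive e U w -> open_cone U.
Proof.
  intros [Hr [Hv [Hp HU]]].
  destruct (lorentz_spec w Hv) as [HW HW2].
  destruct (enthalpy_quadratic_bound e He _ _ Hp Hr) as [Hh Hb].
  apply norm2d_lt_1 in Hv.
  unfold open_cone. rewrite qfun_pos_iff, !HU. unfold conservative, mkstate.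
  set (W := lorentz w) in *. set (h := enthalpy e (pressure w) (density w)) in *.
  set (rho := density w) in *. set (p := pressure w) in *.
  set (v1 := vel1 w) in *. set (v2 := vel2 w) in *.
  clearbody W h rho p v1 v2.
  assert (Hb' : 2 * p * rho * h + rho ^ 2 <= rho ^ 2 * h ^ 2).
  { replace (2 * p * rho * h + rho ^ 2)
      with (rho ^ 2 * (2 * (p / rho) * h + 1)) by (field; lra).
    apply Rmult_le_compat_l; [nra|assumption]. }
  assert (HW1 : 1 <= W ^ 2) by nra.
  assert (Hrh : p < rho * h).
  { assert (0 < rho * h) by (apply Rmult_lt_0_compat; lra). nra. }
  split; [apply Rmult_lt_0_compat; lra|split].
  - assert (0 < rho * h) by (apply Rmult_lt_0_compat; lra). nra.
  - assert (K : (rho * h * W ^ 2 - p) ^ 2 -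
        ((rho * W) ^ 2 + ((rho * h * W ^ 2 * v1) ^ 2 + (rho * h * W ^ 2 * v2) ^ 2))
        = W ^ 2 * (rho ^ 2 * h ^ 2 - (2 * p * rho * h + rho ^ 2)) + p ^ 2
          + rho ^ 2 * h ^ 2 * W ^ 2 * (W ^ 2 * (1 - (v1 ^ 2 + v2 ^ 2)) - 1)) by ring.
    rewrite HW2 in K.
    assert (0 <= W ^ 2 * (rho ^ 2 * h ^ 2 - (2 * p * rho * h + rho ^ 2)))
      by (apply Rmult_le_pos; lra).
    nra.
Qed.

Definition primitive_at (U : state) (p : R) : Defs.primitive :=
  mkprim (density_at (U cD) (U cE) (U cM1 ^ 2 + U cM2 ^ 2) p)
         (U cM1 / (U cE + p)) (U cM2 / (U cE + p)) p.

Lemma primitive_at_correct U p : open_cone U -> 0 < p ->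
  pressure_residual e (U cD) (U cE) (U cM1 ^ 2 + U cM2 ^ 2) p = 0 ->
  is_primitive e U (primitive_at U p).
Proof.
  intros [HD Hq] Hp H0. apply qfun_pos_iff in Hq. destruct Hq as [HE Hq].
  unfold pressure_residual in H0.
  set (Msq := U cM1 ^ 2 + U cM2 ^ 2) in *.
  assert (HM : 0 <= Msq) by (unfold Msq; nra).
  pose proof (energy_over_lorentz_bounds _ _ _ HE HM Hq p (Rlt_le _ _ Hp)) as Hs.
  pose proof (energy_over_lorentz_sq _ _ _ HE Hq p (Rlt_le _ _ Hp)) as Hs2.
  pose proof (density_at_bounds _ _ _ HD HE HM Hq p (Rlt_le _ _ Hp)) as Hr.
  assert (Hr' : density_at (U cD) (U cE) Msq p
    = U cD * energy_over_lorentz (U cE) Msq p / (U cE + p)) by reflexivity.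
  set (s := energy_over_lorentz (U cE) Msq p) in *.
  set (rho := density_at (U cD) (U cE) Msq p) in *.
  assert (Hg : 1 - ((U cM1 / (U cE + p)) ^ 2 + (U cM2 / (U cE + p)) ^ 2)
             = (s / (U cE + p)) ^ 2).
  { apply (Rmult_eq_reg_r ((U cE + p) ^ 2)); [|nra].
    transitivity ((U cE + p) ^ 2 - Msq).
    - unfold Msq. field. lra.
    - rewrite <- Hs2. field. lra. }
  assert (Hsp : 0 < s / (U cE + p)) by (apply Rdiv_lt_0_compat; lra).
  unfold primitive_at. split; [|split; [|split]]; simpl.
  - apply Hr.
  - apply norm2d_lt_1. nra.
  - exact Hp.
  - set (w := mkprim _ _ _ _).
    assert (HW : lorentz w = (U cE + p) / s).
    { unfold lorentz. rewrite norm2d_sq.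
      change (/ sqrt (1 - ((U cM1 / (U cE + p)) ^ 2 + (U cM2 / (U cE + p)) ^ 2))
              = (U cE + p) / s).
      rewrite Hg, sqrt_pow2 by lra. field. lra. }
    assert (HrhoW : rho * lorentz w = U cD).
    { rewrite HW, Hr'. field. lra. }
    assert (HrhW : rho * enthalpy e p rho * lorentz w ^ 2 = U cE + p).
    { replace (rho * enthalpy e p rho * lorentz w ^ 2)
        with (rho * lorentz w * enthalpy e p rho * lorentz w) by ring.
      rewrite HrhoW. replace (U cD * enthalpy e p rho) with s by lra.
      rewrite HW. field. lra. }
    intros [| | |]; unfold conservative, mkstate; cbv zeta;
      change (density w) with rho; change (pressure w) with p;
      rewrite ?HrhoW, ?HrhW; simpl; try (field; lra); reflexivity.
Qed.

Lemma primitive_is_at U w : is_primitive e U w ->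
  pressure_residual e (U cD) (U cE) (U cM1 ^ 2 + U cM2 ^ 2) (pressure w) = 0 /\
  w = primitive_at U (pressure w).
Proof.
  intros HP. pose proof HP as [Hr [Hv [Hp HU]]].
  destruct (lorentz_spec w Hv) as [HW HW2].
  destruct (enthalpy_quadratic_bound e He _ _ Hp Hr) as [Hh _].
  pose proof (HU cD) as HD. pose proof (HU cM1) as HM1.
  pose proof (HU cM2) as HM2. pose proof (HU cE) as HE.
  unfold conservative, mkstate in HD, HM1, HM2, HE.
  destruct w as [rho v1 v2 p]. simpl in *.
  set (w := mkprim rho v1 v2 p) in *.
  set (W := lorentz w) in *. set (h := enthalpy e p rho) in *.
  assert (HW2' : W ^ 2 * (1 - (v1 ^ 2 + v2 ^ 2)) = 1) by (simpl; lra).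
  assert (HEp : U cE + p = rho * h * W ^ 2) by (simpl; lra).
  assert (HH : 0 < rho * h * W ^ 2)
    by (apply Rmult_lt_0_compat; [apply Rmult_lt_0_compat|apply pow_lt]; lra).
  set (Msq := U cM1 * (U cM1 * 1) + U cM2 * (U cM2 * 1)).
  assert (Hs : energy_over_lorentz (U cE) Msq p = rho * h * W).
  { unfold energy_over_lorentz. rewrite HEp.
    replace ((rho * h * W ^ 2) ^ 2 - Msq) with ((rho * h * W) ^ 2).
    - apply sqrt_pow2. apply Rlt_le, Rmult_lt_0_compat; [|exact HW].
      apply Rmult_lt_0_compat; lra.
    - unfold Msq. rewrite HM1, HM2.
      transitivity ((rho * h * W) ^ 2 * (W ^ 2 * (1 - (v1 ^ 2 + v2 ^ 2)))).
      + rewrite HW2'. ring.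
      + ring. }
  assert (Hd : density_at (U cD) (U cE) Msq p = rho).
  { unfold density_at. rewrite Hs, HEp, HD. field. lra. }
  split.
  - unfold pressure_residual. rewrite Hd, Hs, HD. fold h. ring.
  - unfold primitive_at. simpl. fold Msq. rewrite Hd. unfold w. f_equal.
    + rewrite HEp, HM1. field. lra.
    + rewrite HEp, HM2. field. lra.
Qed.

(** The solution of the pressure equation is a primitive state, every primitive
    state comes from a solution of that equation, and the solution is unique. The
    internal energy is positive by the enthalpy bound. *)
Theorem admissible_iff_cone U : admissible e U <-> open_cone U.
Proof.
  split.
  - intros [w [[Hw _] _]]. exact (primitive_in_cone U w Hw).
  - intros HU. pose proof HU as [HD Hq].
    apply qfun_pos_iff in Hq. destruct Hq as [HE Hq].
    assert (HM : 0 <= U cM1 ^ 2 + U cM2 ^ 2) by nra.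
    destruct (pressure_exists e He _ _ _ HD HE HM Hq) as [p [Hp H0]].
    pose proof (primitive_at_correct U p HU Hp H0) as Hw.
    exists (primitive_at U p). split; [split; [exact Hw|]|].
    + intros w' Hw'. destruct (primitive_is_at U w' Hw') as [H0' Heq].
      rewrite Heq. f_equal.
      apply (pressure_unique e He _ _ _ HD HE HM Hq); try assumption.
      apply Hw'.
    + apply internal_energy_pos; [exact He|exact Hp|apply Hw].
Qed.

Lemma primitive_of_correct U :
  admissible e U -> is_primitive e U (primitive_of e U).
Proof.
  intros [w [[Hw _] _]]. unfold primitive_of. apply epsilon_spec. now exists w.
Qed.

(** ** Lax-Friedrichs splitting *)

(** With [H = rho h W ^ 2] and [t = 1 - s u], where [u] is the velocity
    normal to the interface and [s] the sign of the outer normal, the energy of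
    [U - s F] is [H t - p], and its [E ^ 2 - D ^ 2 - |m| ^ 2] is
    [t ^ 2 W ^ 2 (rho ^ 2 h ^ 2 - 2 rho h p - rho ^ 2)], which the enthalpy
    bound makes nonnegative. It may vanish, so that in general [U - s F] only
    lies in the closed cone. *)
Lemma lax_friedrichs_arithmetic rho h W p u u' s :
  0 < rho -> 0 < p -> 0 < h -> 0 < W ->
  2 * (p / rho) * h + 1 <= h ^ 2 ->
  W ^ 2 * (1 - (u ^ 2 + u' ^ 2)) = 1 ->
  s = -1 \/ s = 1 ->
  let H := rho * h * W ^ 2 in
  0 <= rho * W - s * (rho * W * u) /\
  0 <= H - p - s * (H * u) /\
  (rho * W - s * (rho * W * u)) ^ 2
  + ((H * u - s * (u * (H * u) + p)) ^ 2 + (H * u' - s * (u * (H * u'))) ^ 2)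
  <= (H - p - s * (H * u)) ^ 2.
Proof.
  intros Hr Hp Hh HW Hb Hg Hs H.
  assert (Hs2 : s ^ 2 = 1) by (destruct Hs; subst; ring).
  set (t := 1 - s * u).
  assert (Hb' : 2 * p * rho * h + rho ^ 2 <= rho ^ 2 * h ^ 2).
  { replace (2 * p * rho * h + rho ^ 2)
      with (rho ^ 2 * (2 * (p / rho) * h + 1)) by (field; lra).
    apply Rmult_le_compat_l; [nra|assumption]. }
  assert (HW2 : 0 < W ^ 2) by (apply pow_lt; lra).
  assert (Hu : u ^ 2 + u' ^ 2 < 1) by nra.
  assert (Ht : 0 < t < 2) by (unfold t; destruct Hs; subst; nra).
  assert (Hrh : 0 < rho * h) by (apply Rmult_lt_0_compat; lra).
  assert (Hrh2 : 2 * p < rho * h) by nra.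
  assert (HWt : 1 <= 2 * (W ^ 2 * t)).
  { assert (1 <= W ^ 2 * t * (2 - t)).
    { replace (W ^ 2 * t * (2 - t))
        with (W ^ 2 * (1 - (u ^ 2 + u' ^ 2)) + W ^ 2 * u' ^ 2
              + W ^ 2 * u ^ 2 * (1 - s ^ 2)) by (unfold t; ring).
      rewrite Hg, Hs2.
      assert (0 <= W ^ 2 * u' ^ 2) by (apply Rmult_le_pos; nra). lra. }
    assert (0 < W ^ 2 * t) by (apply Rmult_lt_0_compat; lra). nra. }
  assert (Henergy : H - p - s * (H * u) = H * t - p) by (unfold t; ring).
  rewrite Henergy. split; [|split].
  - replace (rho * W - s * (rho * W * u)) with (rho * W * t) by (unfold t; ring).
    apply Rmult_le_pos; [apply Rmult_le_pos|]; lra.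
  - unfold H. replace (rho * h * W ^ 2 * t) with (rho * h * (W ^ 2 * t)) by ring.
    nra.
  - assert (K : (H * t - p) ^ 2
      - ((rho * W - s * (rho * W * u)) ^ 2
         + ((H * u - s * (u * (H * u) + p)) ^ 2 + (H * u' - s * (u * (H * u'))) ^ 2))
      = t ^ 2 * W ^ 2 * (rho ^ 2 * h ^ 2 * (W ^ 2 * (1 - (u ^ 2 + u' ^ 2)))
                         - (2 * p * rho * h + rho ^ 2)))
      by (unfold t, H; destruct Hs; subst s; ring).
    rewrite Hg in K.
    assert (0 <= t ^ 2 * W ^ 2 * (rho ^ 2 * h ^ 2 * 1 - (2 * p * rho * h + rho ^ 2))).
    { apply Rmult_le_pos; [apply Rmult_le_pos|]; nra. }
    lra.
Qed.

Lemma lax_friedrichs1 U s : admissible e U -> s = -1 \/ s = 1 ->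
  closed_cone (fun k => U k - s * flux1 e U k).
Proof.
  intros HU Hs.
  destruct (primitive_of_correct U HU) as [Hr [Hv [Hp HUk]]].
  unfold flux1. set (w := primitive_of e U) in *. clearbody w.
  destruct (lorentz_spec w Hv) as [HW HW2].
  destruct (enthalpy_quadratic_bound e He _ _ Hp Hr) as [Hh Hb].
  destruct (lax_friedrichs_arithmetic _ _ _ _ (vel1 w) (vel2 w) s
              Hr Hp Hh HW Hb HW2 Hs) as [H1 [H2 H3]].
  split; [|apply qfun_nonneg]; unfold mkstate; cbv beta iota;
    rewrite !HUk; assumption.
Qed.

Lemma lax_friedrichs2 U s : admissible e U -> s = -1 \/ s = 1 ->
  closed_cone (fun k => U k - s * flux2 e U k).
Proof.
  intros HU Hs.
  destruct (primitive_of_correct U HU) as [Hr [Hv [Hp HUk]]].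
  unfold flux2. set (w := primitive_of e U) in *. clearbody w.
  destruct (lorentz_spec w Hv) as [HW HW2]. rewrite Rplus_comm in HW2.
  destruct (enthalpy_quadratic_bound e He _ _ Hp Hr) as [Hh Hb].
  destruct (lax_friedrichs_arithmetic _ _ _ _ (vel2 w) (vel1 w) s
              Hr Hp Hh HW Hb HW2 Hs) as [H1 [H2 H3]].
  rewrite (Rplus_comm (_ ^ 2) (_ ^ 2)) in H3.
  split; [|apply qfun_nonneg]; unfold mkstate; cbv beta iota;
    rewrite !HUk; assumption.
Qed.

End Admissible.

(** * The limiter *)

Lemma min_over_le S f x y : In (x, y) S -> min_over S f <= f x y.
Proof.
  destruct S as [|P0 S]; simpl; [easy|].
  assert (K : forall T, fold_right (fun P' m => Rmin (f (fst P') (snd P')) m)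
                (f (fst P0) (snd P0)) T <= f (fst P0) (snd P0) /\
              (In (x, y) T -> fold_right (fun P' m => Rmin (f (fst P') (snd P')) m)
                (f (fst P0) (snd P0)) T <= f x y)).
  { intros T. induction T as [|P T [IH1 IH2]]; simpl; [split; [lra|easy]|].
    split.
    - eapply Rle_trans; [apply Rmin_r|exact IH1].
    - intros [->|HT].
      + apply Rmin_l.
      + eapply Rle_trans; [apply Rmin_r|]. now apply IH2. }
  intros [->|HS]; [apply (proj1 (K S))|exact (proj2 (K S) HS)].
Qed.

(** The scaling factor [(A - eps) / (A - m)] moves the value [m < eps] towards
    [A >= eps] exactly up to [eps]. *)
Lemma limiter_factor A eps m : eps <= A -> m < eps ->
  let theta := (A - eps) / (A - m) in
  0 <= theta < 1 /\ theta * (m - A) + A = eps.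
Proof.
  intros HA Hm theta.
  assert (0 < A - m) by lra.
  split; [split|].
  - apply Rdiv_le_0_compat; lra.
  - apply Rlt_div_l; lra.
  - unfold theta. field. lra.
Qed.

Lemma limit_density_ge S eps Ubar U x y : eps <= Ubar cD -> In (x, y) S ->
  eps <= limit_density S eps Ubar U x y cD.
Proof.
  intros Heps HS. unfold limit_density, mkstate.
  pose proof (min_over_le S (fun x y => U x y cD) x y HS) as Hmin.
  destruct (Rlt_dec _ _) as [Hlt|Hge]; [|cbv beta in Hmin; lra].
  destruct (limiter_factor _ _ _ Heps Hlt) as [Ht Heq].
  cbv beta in Hmin. nra.
Qed.

(** Along the segment from the average to the solution, [q] is concave and equals
    [q(Ubar)] at one end, so the factor chosen for the smallest value of [q]
    brings every other value to at least [eps] too. *)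
Lemma limiter_in_cone S eps Ubar U x y :
  0 < eps -> eps <= Ubar cD -> eps <= qfun Ubar -> In (x, y) S ->
  open_cone (limit_q S eps Ubar (limit_density S eps Ubar U) x y).
Proof.
  intros Heps HD Hq HS.
  pose proof (limit_density_ge S eps Ubar U x y HD HS) as HD'.
  set (V := limit_density S eps Ubar U) in *. clearbody V.
  unfold limit_q.
  pose proof (min_over_le S (fun x y => qfun (V x y)) x y HS) as Hmin.
  cbv beta in Hmin.
  destruct (Rlt_dec _ _) as [Hlt|Hge].
  - destruct (limiter_factor _ _ _ Hq Hlt) as [Ht Heq].
    set (theta := _ / _) in *.
    apply (open_cone_ext
      (state_add (state_scale theta (V x y)) (state_scale (1 - theta) Ubar))).
    { intros k. unfold state_add, state_scale. ring. }
    split.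
    + unfold state_add, state_scale. nra.
    + pose proof (qfun_add (state_scale theta (V x y)) (state_scale (1 - theta) Ubar)).
      rewrite !qfun_scale in H by lra. nra.
  - apply (open_cone_ext (V x y)); [reflexivity|]. split; lra.
Qed.

(** * Polynomials *)

Lemma poly1_ext n f g : (forall x, f x = g x) -> is_poly1 n f -> is_poly1 n g.
Proof. intros H [a Ha]. exists a. intros x. now rewrite <- H. Qed.

Lemma poly1_plus n f g :
  is_poly1 n f -> is_poly1 n g -> is_poly1 n (fun x => f x + g x).
Proof.
  intros [a Ha] [b Hb]. exists (fun i => a i + b i). intros x.
  rewrite Ha, Hb.
  rewrite <- (sum_n_plus (fun i => a i * x ^ i) (fun i => b i * x ^ i)).
  apply sum_n_ext. intros i. unfold plus. simpl. ring.
Qed.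

Lemma poly1_scal n c f : is_poly1 n f -> is_poly1 n (fun x => c * f x).
Proof.
  intros [a Ha]. exists (fun i => c * a i). intros x. rewrite Ha.
  rewrite <- (sum_n_mult_l (K := R_Ring) c (fun i => a i * x ^ i)).
  apply sum_n_ext. intros i. unfold mult. simpl. ring.
Qed.

Lemma poly1_S n f : is_poly1 n f -> is_poly1 (S n) f.
Proof.
  intros [a Ha]. exists (fun i => if Nat.leb i n then a i else 0). intros x.
  rewrite sum_Sn, Ha.
  replace (Nat.leb (S n) n) with false by (symmetry; apply Nat.leb_gt; lia).
  rewrite Rmult_0_l. unfold plus. simpl. rewrite Rplus_0_r.
  apply sum_n_ext_loc. intros i Hi.
  now replace (Nat.leb i n) with true by (symmetry; apply Nat.leb_le; lia).
Qed.

Lemma poly1_mono n m f : (n <= m)%nat -> is_poly1 n f -> is_poly1 m f.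
Proof. intros H Hf. induction H; [exact Hf|now apply poly1_S]. Qed.

Lemma poly1_const n c : is_poly1 n (fun _ => c).
Proof.
  apply (poly1_mono 0); [lia|]. exists (fun _ => c). intros x.
  rewrite sum_O. simpl. ring.
Qed.

Lemma poly1_mul_x n f : is_poly1 n f -> is_poly1 (S n) (fun x => x * f x).
Proof.
  intros [a Ha]. exists (fun i => match i with O => 0 | S j => a j end).
  intros x. rewrite Ha. clear Ha f. induction n as [|n IH].
  - rewrite sum_Sn, !sum_O. unfold plus. simpl. ring.
  - symmetry. etransitivity; [apply sum_Sn|].
    etransitivity; [apply (f_equal2 plus); [exact (eq_sym IH)|reflexivity]|].
    rewrite sum_Sn. unfold plus. simpl. ring.
Qed.

Lemma poly1_mul_affine n u v f :
  is_poly1 n f -> is_poly1 (S n) (fun x => (u * x + v) * f x).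
Proof.
  intros Hf. apply (poly1_ext _ (fun x => u * (x * f x) + v * f x)).
  - intros x. ring.
  - apply poly1_plus; apply poly1_scal; [now apply poly1_mul_x|now apply poly1_S].
Qed.

Lemma poly1_affine_pow u v i : is_poly1 i (fun x => (u * x + v) ^ i).
Proof.
  induction i as [|i IH].
  - exact (poly1_const 0 1).
  - exact (poly1_mul_affine i u v _ IH).
Qed.

Lemma poly1_sum_n n m (F : nat -> R -> R) :
  (forall i, (i <= m)%nat -> is_poly1 n (F i)) ->
  is_poly1 n (fun x => sum_n (fun i => F i x) m).
Proof.
  induction m as [|m IH]; intros HF.
  - apply (poly1_ext _ (F O)); [|now apply HF]. intros x. now rewrite sum_O.
  - apply (poly1_ext _ (fun x => sum_n (fun i => F i x) m + F (S m) x)).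
    + intros x. now rewrite sum_Sn.
    + apply poly1_plus; [|now apply HF]. apply IH. intros i Hi. apply HF. lia.
Qed.

Lemma poly1_sum_n_m n p m (F : nat -> R -> R) :
  (forall i, is_poly1 n (F i)) ->
  is_poly1 n (fun x => sum_n_m (fun i => F i x) p m).
Proof.
  intros HF. destruct (Nat.le_gt_cases p m) as [H|H].
  - induction H as [|m H IH].
    + apply (poly1_ext _ (F p)); [|apply HF]. intros x. now rewrite sum_n_n.
    + apply (poly1_ext _ (fun x => sum_n_m (fun i => F i x) p m + F (S m) x)).
      * intros x. now rewrite sum_n_Sm by lia.
      * now apply poly1_plus.
  - apply (poly1_ext _ (fun _ => 0)); [|apply poly1_const].
    intros x. now rewrite sum_n_m_zero.
Qed.

Lemma poly1_comp_affine n u v f :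
  is_poly1 n f -> is_poly1 n (fun x => f (u * x + v)).
Proof.
  intros [a Ha].
  apply (poly1_ext _ (fun x => sum_n (fun i => a i * (u * x + v) ^ i) n)).
  - intros x. now rewrite Ha.
  - apply poly1_sum_n. intros i Hi. apply poly1_scal.
    apply (poly1_mono i); [exact Hi|apply poly1_affine_pow].
Qed.

Lemma poly1_monomial n i c : (i <= n)%nat -> is_poly1 n (fun x => c * x ^ i).
Proof.
  intros H. apply poly1_scal, (poly1_mono i); [exact H|].
  apply (poly1_ext _ (fun x => (1 * x + 0) ^ i)); [|apply poly1_affine_pow].
  intros x. f_equal. ring.
Qed.

Lemma ex_RInt_poly1 n f a b : is_poly1 n f -> ex_RInt f a b.
Proof.
  intros [c Hc]. apply (ex_RInt_ext (fun x => sum_n (fun i => c i * x ^ i) n)).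
  { intros x _. now rewrite Hc. }
  apply (ex_RInt_continuous (V := R_CompleteNormedModule)). intros x _.
  apply (ex_derive_continuous (fun x => sum_n (fun i => c i * x ^ i) n)).
  apply (ex_derive_sum_n (fun i x => c i * x ^ i)).
  intros i _. auto_derive. exact I.
Qed.

Lemma poly2_plus n f g :
  is_poly2 n f -> is_poly2 n g -> is_poly2 n (fun x y => f x y + g x y).
Proof.
  intros [a Ha] [b Hb]. exists (fun i j => a i j + b i j). intros x y.
  rewrite Ha, Hb, <- (sum_n_plus (G := R_AbelianMonoid)).
  apply sum_n_ext. intros i. rewrite <- sum_n_plus.
  apply sum_n_ext. intros j. unfold plus. simpl. ring.
Qed.

Lemma poly2_scal n c f : is_poly2 n f -> is_poly2 n (fun x y => c * f x y).
Proof.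
  intros [a Ha]. exists (fun i j => c * a i j). intros x y.
  rewrite Ha, <- (sum_n_mult_l (K := R_Ring) c).
  apply sum_n_ext. intros i. rewrite <- (sum_n_mult_l (K := R_Ring) c).
  apply sum_n_ext. intros j. unfold mult. simpl. ring.
Qed.

Lemma poly2_ext n f g :
  (forall x y, f x y = g x y) -> is_poly2 n f -> is_poly2 n g.
Proof. intros H [a Ha]. exists a. intros x y. now rewrite <- H. Qed.

Lemma sum_n_first (F : nat -> R) n :
  (forall i, (0 < i)%nat -> F i = 0) -> sum_n F n = F O.
Proof.
  intros HF. induction n as [|n IH]; [apply sum_O|].
  rewrite sum_Sn, IH, (HF (S n)) by lia. unfold plus. simpl. ring.
Qed.

Lemma poly2_const n c : is_poly2 n (fun _ _ => c).
Proof.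
  exists (fun i j => match i, j with O, O => c | _, _ => 0 end). intros x y.
  rewrite sum_n_first; [rewrite sum_n_first|].
  - simpl. ring.
  - intros [|j] Hj; [lia|]. ring.
  - intros [|i] Hi; [lia|]. rewrite sum_n_first; [ring|]. intros; ring.
Qed.

Lemma poly2_slice_y n f x : is_poly2 n f -> is_poly1 n (fun y => f x y).
Proof.
  intros [a Ha].
  eapply poly1_ext; [intros y; symmetry; apply Ha|].
  apply poly1_sum_n. intros i Hi. apply poly1_sum_n. intros j Hj.
  apply (poly1_monomial n j (a i j * x ^ i)). lia.
Qed.

Lemma poly2_slice_x n f y : is_poly2 n f -> is_poly1 n (fun x => f x y).
Proof.
  intros [a Ha].
  eapply poly1_ext; [intros x; symmetry; apply Ha|].
  apply poly1_sum_n. intros i Hi. apply poly1_sum_n. intros j Hj.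
  apply (poly1_ext _ (fun x => a i j * y ^ j * x ^ i)); [intros; ring|].
  apply (poly1_monomial n i (a i j * y ^ j)). lia.
Qed.

Lemma limit_poly n S eps Ubar U :
  (forall k, is_poly2 n (fun x y => U x y k)) ->
  forall k, is_poly2 n
    (fun x y => limit_q S eps Ubar (limit_density S eps Ubar U) x y k).
Proof.
  intros HU.
  assert (affine : forall f t c, is_poly2 n f ->
            is_poly2 n (fun x y => t * (f x y - c) + c)).
  { intros f t c Hf.
    apply (poly2_ext _ (fun x y => t * f x y + (c - t * c))); [intros; ring|].
    apply poly2_plus; [now apply poly2_scal|apply poly2_const]. }
  assert (HV : forall k, is_poly2 n (fun x y => limit_density S eps Ubar U x y k)).
  { intros [| | |]; unfold limit_density, mkstate; try apply HU.
    destruct (Rlt_dec _ _); [|apply HU]. apply (affine _ _ _ (HU cD)). }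
  intros k. unfold limit_q. destruct (Rlt_dec _ _); [|apply HV].
  apply (affine _ _ _ (HV k)).
Qed.

(** * Quadrature on half intervals *)

Lemma sum_n_m_Rmult (c : R) (u : nat -> R) n m :
  sum_n_m (fun a => c * u a) n m = c * sum_n_m u n m.
Proof. exact (sum_n_m_mult_l (K := R_Ring) c u n m). Qed.

Lemma sum_n_m_Rplus (u v : nat -> R) n m :
  sum_n_m (fun a => u a + v a) n m = sum_n_m u n m + sum_n_m v n m.
Proof. exact (sum_n_m_plus (G := R_AbelianMonoid) u v n m). Qed.

Lemma sum_n_m_R0 n m : sum_n_m (fun _ => 0) n m = 0.
Proof. exact (sum_n_m_const_zero (G := R_AbelianMonoid) n m). Qed.

Lemma sum_n_m_Rlast (u : nat -> R) n m : (n <= S m)%nat ->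
  sum_n_m u n (S m) = sum_n_m u n m + u (S m).
Proof. exact (sum_n_Sm (G := R_AbelianMonoid) u n m). Qed.

Lemma sum_n_m_Rfirst (u : nat -> R) n m : (n <= m)%nat ->
  sum_n_m u n m = u n + sum_n_m u (S n) m.
Proof. exact (sum_Sn_m (G := R_AbelianMonoid) u n m). Qed.

Lemma sum_n_m_Rext (u v : nat -> R) n m :
  (forall a, (n <= a <= m)%nat -> u a = v a) -> sum_n_m u n m = sum_n_m v n m.
Proof. apply sum_n_m_ext_loc. Qed.

Lemma sum_n_m_single (c : R) k n : (1 <= k <= n)%nat ->
  sum_n_m (fun a => if Nat.eq_dec a k then c else 0) 1 n = c.
Proof.
  intros Hk. induction n as [|n IH]; [lia|].
  rewrite sum_n_m_Rlast by lia.
  destruct (Nat.eq_dec (S n) k) as [Hn|Hn].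
  - rewrite (sum_n_m_Rext _ (fun _ => 0)), sum_n_m_R0; [apply Rplus_0_l|].
    intros a Ha. destruct (Nat.eq_dec a k); [lia|reflexivity].
  - rewrite IH by lia. apply Rplus_0_r.
Qed.

Lemma sum_n_m_exchange (u : nat -> nat -> R) s t :
  sum_n_m (fun i => sum_n_m (u i) 1 t) 1 s =
  sum_n_m (fun j => sum_n_m (fun i => u i j) 1 s) 1 t.
Proof.
  induction s as [|s IH].
  - rewrite sum_n_m_zero by lia. symmetry.
    rewrite (sum_n_m_ext _ (fun _ => zero)); [apply sum_n_m_const_zero|].
    intros j. now rewrite sum_n_m_zero by lia.
  - rewrite sum_n_Sm, IH by lia. rewrite <- sum_n_m_plus.
    apply sum_n_m_ext. intros j. now rewrite sum_n_Sm by lia.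
Qed.

Lemma exact_to_degree_mono deg deg' n node w :
  (deg <= deg')%nat -> exact_to_degree deg' n node w ->
  exact_to_degree deg n node w.
Proof. intros H Hex f Hf. apply Hex. now apply (poly1_mono deg). Qed.

Lemma quadrature_affine deg n node w f c h :
  exact_to_degree deg n node w -> is_poly1 deg f ->
  RInt f (c - h) (c + h) = 2 * h * sum_n_m (fun a => w a * f (c + h * node a)) 1 n.
Proof.
  intros Hex Hf.
  pose proof (RInt_comp_lin f h c (-1) 1 (ex_RInt_poly1 _ _ _ _ Hf)) as H.
  replace (h * -1 + c) with (c - h) in H by ring.
  replace (h * 1 + c) with (c + h) in H by ring.
  rewrite <- H.
  specialize (Hex _ (poly1_scal _ h _ (poly1_comp_affine _ h c _ Hf))).
  change (fun y : R => scal h (f (h * y + c))) with (fun y => h * f (h * y + c)).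
  replace (RInt (fun y => h * f (h * y + c)) (-1) 1)
    with (2 * (RInt (fun y => h * f (h * y + c)) (-1) 1 / 2)) by field.
  rewrite <- Hex.
  rewrite (Rmult_assoc 2 h), <- (sum_n_m_Rmult h).
  f_equal. apply sum_n_m_Rext. intros a _.
  replace (h * node a + c) with (c + h * node a) by ring. ring.
Qed.

(** The integrand is [p (-1)] on the left half and [p 1] on the right half: the
    solution on the other mesh jumps in the middle of a cell. *)
Definition line_mean (c len : R) (n : nat) (node w : nat -> R) (p : R -> R -> R) :
    R :=
  1 / 2 * sum_n_m (fun a => w a * sum_pm (fun l => p l (half_node c len l (node a))))
                  1 n.

Lemma RInt_line_mean deg n node w c len f p :
  0 < len -> exact_to_degree deg n node w ->
  (forall l, l = -1 \/ l = 1 -> is_poly1 deg (p l)) ->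
  (forall l x, l = -1 \/ l = 1 -> 0 < l * (x - c) < len / 2 -> f x = p l x) ->
  RInt f (c - len / 2) (c + len / 2) = len * line_mean c len n node w p.
Proof.
  intros Hlen Hex Hp Hf.
  assert (HL : forall x, Rmin (c - len / 2) c < x < Rmax (c - len / 2) c ->
                 p (-1) x = f x).
  { intros x. rewrite Rmin_left, Rmax_right by lra. intros Hx.
    symmetry. apply Hf; [now left|lra]. }
  assert (HR : forall x, Rmin c (c + len / 2) < x < Rmax c (c + len / 2) ->
                 p 1 x = f x).
  { intros x. rewrite Rmin_left, Rmax_right by lra. intros Hx.
    symmetry. apply Hf; [now right|lra]. }
  pose proof (Hp (-1) (or_introl eq_refl)) as P1.
  pose proof (Hp 1 (or_intror eq_refl)) as P2.
  rewrite <- (RInt_Chasles f (c - len / 2) c (c + len / 2)).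
  - rewrite <- (RInt_ext _ _ _ _ HL), <- (RInt_ext _ _ _ _ HR).
    pose proof (quadrature_affine deg n node w (p (-1)) (c - len / 4) (len / 4) Hex P1)
      as Q1.
    pose proof (quadrature_affine deg n node w (p 1) (c + len / 4) (len / 4) Hex P2)
      as Q2.
    replace (c - len / 4 - len / 4) with (c - len / 2) in Q1 by field.
    replace (c - len / 4 + len / 4) with c in Q1 by field.
    replace (c + len / 4 - len / 4) with c in Q2 by field.
    replace (c + len / 4 + len / 4) with (c + len / 2) in Q2 by field.
    rewrite Q1, Q2. unfold line_mean.
    replace (2 * (len / 4)) with (len * (1 / 2)) by field.
    unfold plus. simpl.
    rewrite 2!(Rmult_assoc len), <- Rmult_plus_distr_l, <- Rmult_plus_distr_l.
    f_equal. f_equal.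
    rewrite <- sum_n_m_Rplus.
    apply sum_n_m_Rext. intros a _. unfold sum_pm, half_node, plus. simpl.
    replace (c + -1 * (len / 4) + len / 4 * node a)
      with (c - len / 4 + len / 4 * node a) by ring.
    replace (c + 1 * (len / 4) + len / 4 * node a)
      with (c + len / 4 + len / 4 * node a) by ring.
    ring.
  - apply (ex_RInt_ext _ _ _ _ HL), (ex_RInt_poly1 deg), P1.
  - apply (ex_RInt_ext _ _ _ _ HR), (ex_RInt_poly1 deg), P2.
Qed.

Lemma line_mean_ext c len n node w p q :
  (forall l a, l = -1 \/ l = 1 -> (1 <= a <= n)%nat ->
    p l (half_node c len l (node a)) = q l (half_node c len l (node a))) ->
  line_mean c len n node w p = line_mean c len n node w q.
Proof.
  intros H. unfold line_mean. f_equal. apply sum_n_m_Rext. intros a Ha.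
  unfold sum_pm. rewrite !H by auto. reflexivity.
Qed.

Lemma line_mean_plus c len n node w p q :
  line_mean c len n node w (fun l x => p l x + q l x) =
  line_mean c len n node w p + line_mean c len n node w q.
Proof.
  unfold line_mean. rewrite <- Rmult_plus_distr_l. f_equal.
  rewrite <- sum_n_m_Rplus.
  apply sum_n_m_Rext. intros a _. unfold sum_pm, plus. simpl. ring.
Qed.

Lemma line_mean_scal c len n node w r p :
  line_mean c len n node w (fun l x => r * p l x) =
  r * line_mean c len n node w p.
Proof.
  unfold line_mean.
  rewrite <- Rmult_assoc, (Rmult_comm r), Rmult_assoc. f_equal.
  rewrite <- (sum_n_m_Rmult r).
  apply sum_n_m_Rext. intros a _. unfold sum_pm, mult. simpl. ring.
Qed.

(** Lines in either direction can be taken as the outer ones, although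
    [cell_integral] fixes one order. *)
Lemma line_mean_exchange c len n node w c' len' n' node' w'
    (p : R -> R -> R -> R -> R) :
  line_mean c len n node w
    (fun l x => line_mean c' len' n' node' w' (fun m y => p l x m y)) =
  line_mean c' len' n' node' w'
    (fun m y => line_mean c len n node w (fun l x => p l x m y)).
Proof.
  unfold line_mean.
  transitivity (1 / 2 * (1 / 2 * sum_n_m (fun a => sum_n_m (fun b =>
    w a * w' b * sum_pm (fun l => sum_pm (fun m =>
      p l (half_node c len l (node a)) m (half_node c' len' m (node' b))))) 1 n') 1 n)).
  - f_equal. rewrite <- (sum_n_m_Rmult (1 / 2)).
    apply sum_n_m_Rext. intros a _. unfold sum_pm at 1.
    rewrite <- Rmult_plus_distr_l, <- sum_n_m_Rplus, <- 3!sum_n_m_Rmult.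
    apply sum_n_m_Rext. intros b _. unfold sum_pm. ring.
  - rewrite sum_n_m_exchange. f_equal. rewrite <- (sum_n_m_Rmult (1 / 2)).
    apply sum_n_m_Rext. intros b _. unfold sum_pm at 3.
    rewrite <- Rmult_plus_distr_l, <- sum_n_m_Rplus, <- 3!sum_n_m_Rmult.
    apply sum_n_m_Rext. intros a _. unfold sum_pm. ring.
Qed.

Lemma poly1_line_mean deg c len n node w (p : R -> R -> R -> R) :
  (forall m y, m = -1 \/ m = 1 -> is_poly1 deg (fun x => p x m y)) ->
  is_poly1 deg (fun x => line_mean c len n node w (p x)).
Proof.
  intros H. unfold line_mean. apply poly1_scal.
  apply (poly1_sum_n_m deg 1 n
    (fun a x => w a * sum_pm (fun l => p x l (half_node c len l (node a))))).
  intros a. apply poly1_scal. apply poly1_plus; apply H; auto.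
Qed.

Lemma open_cone_line_mean c len n node w (Z : R -> R -> state) :
  (1 <= n)%nat -> (forall a, (1 <= a <= n)%nat -> 0 < w a) ->
  (forall l a, l = -1 \/ l = 1 -> (1 <= a <= n)%nat ->
    open_cone (Z l (half_node c len l (node a)))) ->
  open_cone (fun k => line_mean c len n node w (fun l x => Z l x k)).
Proof.
  intros Hn Hw HZ.
  apply (open_cone_scale (1 / 2) (fun k => sum_n_m (fun a =>
    w a * sum_pm (fun l => Z l (half_node c len l (node a)) k)) 1 n)); [lra|].
  apply (open_cone_sum (fun a k =>
    w a * sum_pm (fun l => Z l (half_node c len l (node a)) k))); [exact Hn|].
  intros a Ha.
  apply (open_cone_scale (w a) (fun k =>
    sum_pm (fun l => Z l (half_node c len l (node a)) k))); [now apply Hw|].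
  apply (open_cone_add (Z (-1) _) (Z 1 _)); [|apply open_cone_closed];
    apply HZ; auto.
Qed.

(** ** Symmetry of the end weights of a Gauss-Lobatto rule *)

(** The roots are the nodes of indices 2 to [k + 1]; a rule with [n] nodes has
    the interior nodes 2 to [n - 1], so [k = n - 2] is the case of interest. *)
Fixpoint interior_poly (node : nat -> R) (k : nat) (x : R) : R :=
  match k with
  | O => 1
  | S k => (x - node (S (S k))) * interior_poly node k x
  end.

Lemma interior_poly_root node k x a :
  (2 <= a <= S k)%nat -> x = node a -> interior_poly node k x = 0.
Proof.
  induction k as [|k IH]; intros Ha Hx; [lia|]. simpl.
  destruct (Nat.eq_dec a (S (S k))) as [->|Hne].
  - rewrite Hx. ring.
  - rewrite IH; [ring|lia|exact Hx].
Qed.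

Lemma interior_poly_nonzero node k x :
  (forall a, (2 <= a <= S k)%nat -> x <> node a) -> interior_poly node k x <> 0.
Proof.
  induction k as [|k IH]; intros Hx; simpl; [lra|].
  apply Rmult_integral_contrapositive_currified.
  - assert (x <> node (S (S k))) by (apply Hx; lia). lra.
  - apply IH. intros a Ha. apply Hx. lia.
Qed.

(** [(1 - x) pi(x) pi(-x)], with [pi] the interior node polynomial, has degree
    [2 n - 3], which the rule still integrates; it vanishes at all nodes but the
    first. Its mirror image, which has the same integral, vanishes at all nodes
    but the last. *)
Lemma lobatto_end_weights n node w :
  (2 <= n)%nat -> gauss_lobatto_rule n node w -> w n = w 1%nat.
Proof.
  intros Hn HL.
  pose proof (lobatto_first _ _ _ HL) as H1. pose proof (lobatto_last _ _ _ HL) as H2.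
  pose proof (lobatto_increasing _ _ _ HL) as Hinc.
  pose proof (lobatto_exact _ _ _ HL) as Hex.
  set (P := interior_poly node (n - 2)).
  assert (Ppoly : forall k i g, is_poly1 i g ->
            is_poly1 (k + i) (fun x => interior_poly node k x * g x)).
  { intros k i g Hg. induction k as [|k IH]; simpl.
    - apply (poly1_ext _ g); [intros; ring|exact Hg].
    - apply (poly1_ext _ (fun x => (1 * x + - node (S (S k)))
                                   * (interior_poly node k x * g x))).
      + intros x. ring.
      + now apply poly1_mul_affine. }
  set (f := fun x => (1 - x) * (P x * P (- x))).
  assert (Pneg : is_poly1 (n - 2) (fun x => P (- x))).
  { apply (poly1_ext _ (fun x => P (-1 * x + 0))).
    - intros x. f_equal. ring.
    - apply poly1_comp_affine.
      apply (poly1_ext _ (fun x => P x * 1)); [intros; ring|].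
      replace (n - 2)%nat with (n - 2 + 0)%nat by lia.
      apply (Ppoly (n - 2)%nat 0%nat), poly1_const. }
  assert (fpoly : is_poly1 (2 * n - 3) f).
  { replace (2 * n - 3)%nat with (S (n - 2 + (n - 2))) by lia.
    apply (poly1_ext _ (fun x => (-1 * x + 1) * (P x * P (- x)))).
    - intros x. unfold f. ring.
    - apply poly1_mul_affine, Ppoly, Pneg. }
  assert (gpoly : is_poly1 (2 * n - 3) (fun x => f (- x))).
  { apply (poly1_ext _ (fun x => f (-1 * x + 0))).
    - intros x. f_equal. ring.
    - now apply poly1_comp_affine. }
  assert (Hint : RInt (fun x => f (- x)) (-1) 1 = RInt f (-1) 1).
  { pose proof (RInt_comp_lin f (-1) 0 (-1) 1 (ex_RInt_poly1 _ _ _ _ fpoly)) as H.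
    replace (-1 * -1 + 0) with 1 in H by ring.
    replace (-1 * 1 + 0) with (-1) in H by ring.
    rewrite <- (opp_RInt_swap f) in H by (eapply ex_RInt_poly1; exact fpoly).
    assert (H' : RInt (fun x => -1 * f (- x)) (-1) 1 = -1 * RInt (fun x => f (- x)) (-1) 1)
      by (apply (RInt_scal (fun x => f (- x)) (-1) 1 (-1));
          eapply ex_RInt_poly1; exact gpoly).
    rewrite (RInt_ext _ (fun x => -1 * f (- x))) in H
      by (intros x _; change (-1 * f (-1 * x + 0) = -1 * f (- x));
          do 2 f_equal; ring).
    change (opp (RInt f (-1) 1)) with (- RInt f (-1) 1) in H. lra. }
  assert (Hroot : forall a, (1 < a < n)%nat -> P (node a) = 0).
  { intros a Ha. apply (interior_poly_root _ _ _ a); [lia|reflexivity]. }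
  pose proof (Hex _ fpoly) as Ef. pose proof (Hex _ gpoly) as Eg.
  rewrite Hint, <- Ef in Eg. clear Ef.
  rewrite (sum_n_m_Rext _ (fun a => if Nat.eq_dec a n then w n * f (-1) else 0))
    in Eg.
  2:{ intros a Ha. destruct (Nat.eq_dec a n) as [->|Hne]; [now rewrite H2|].
      unfold f. destruct (Nat.eq_dec a 1) as [->|Hne1].
      - rewrite H1. ring.
      - rewrite Ropp_involutive, Hroot by lia. ring. }
  symmetry in Eg.
  rewrite (sum_n_m_Rext _ (fun a => if Nat.eq_dec a 1 then w 1%nat * f (-1) else 0)
             1 n) in Eg.
  2:{ intros a Ha. destruct (Nat.eq_dec a 1) as [->|Hne]; [now rewrite H1|].
      unfold f. destruct (Nat.eq_dec a n) as [->|Hne1].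
      - rewrite H2. ring.
      - rewrite Hroot by lia. ring. }
  rewrite !sum_n_m_single in Eg by lia.
  assert (Hf : f (-1) <> 0).
  { unfold f, P. replace (- -1) with 1 by ring.
    apply Rmult_integral_contrapositive_currified; [lra|].
    apply Rmult_integral_contrapositive_currified;
      apply interior_poly_nonzero; intros a Ha.
    - pose proof (Hinc 1%nat a ltac:(lia) ltac:(lia)). lra.
    - pose proof (Hinc a n ltac:(lia) ltac:(lia)). lra. }
  symmetry in Eg. apply (Rmult_eq_reg_r (f (-1))); lra.
Qed.

(** * Cell averages *)

(** Where the half [l] (-1 for left, 1 for right) of interval [i] of mesh [M]
    lies on the other mesh. *)
Definition other_index (M : mesh) (i : Z) (l : R) : Z :=
  match M with
  | primal => if Rlt_dec l 0 then (i - 1)%Z else i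
  | dual => if Rlt_dec l 0 then i else (i + 1)%Z
  end.

Lemma other_index_center o len M i l : l = -1 \/ l = 1 ->
  o + (IZR (other_index M i l) + offset (other M)) * len
  = o + (IZR i + offset M) * len + l * (len / 2).
Proof.
  intros [->| ->]; destruct M; simpl; destruct (Rlt_dec _ 0); try lra;
    rewrite ?minus_IZR, ?plus_IZR; field.
Qed.

Lemma Int_part_other_index o len M i l x :
  0 < len -> l = -1 \/ l = 1 ->
  0 < l * (x - (o + (IZR i + offset M) * len)) < len ->
  Int_part ((x - o) / len - offset (other M) + 1 / 2) = other_index M i l.
Proof.
  intros Hlen Hl Hx. symmetry. apply Int_part_spec.
  set (z := (x - o) / len).
  assert (Hz : 0 < l * (z - (IZR i + offset M)) < 1).
  { replace (l * (z - (IZR i + offset M)))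
      with (l * (x - (o + (IZR i + offset M) * len)) / len) by (unfold z; field; lra).
    split; [apply Rdiv_lt_0_compat|apply Rlt_div_l]; lra. }
  destruct Hl as [->| ->]; destruct M; simpl in *; destruct (Rlt_dec _ 0);
    rewrite ?minus_IZR, ?plus_IZR; lra.
Qed.

Section Averages.

Variable d : discretization.
Hypothesis Hd : discretization_ok d.

Let X M i := half_node (xc d M i) (dx d).
Let Y M j := half_node (yc d M j) (dy d).

(** The left half of a cell is the right half of a cell of the other mesh, and
    vice versa: hence the change of sign. *)
Lemma half_node_other_x M i l xi : l = -1 \/ l = 1 ->
  X (other M) (other_index M i l) (- l) xi = X M i l xi.
Proof.
  intros Hl. unfold X, half_node, xc. rewrite other_index_center by exact Hl. field.
Qed.

Lemma half_node_other_y M j m xi : m = -1 \/ m = 1 ->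
  Y (other M) (other_index M j m) (- m) xi = Y M j m xi.
Proof.
  intros Hm. unfold Y, half_node, yc. rewrite other_index_center by exact Hm. field.
Qed.

(** The bound is [dx] rather than [dx / 2], so that the end points of the cell,
    where the fluxes are evaluated, are included: they are centres of cells of
    the other mesh, hence points of continuity. *)
Lemma value_other (U : field) M i j l m x y :
  l = -1 \/ l = 1 -> m = -1 \/ m = 1 ->
  0 < l * (x - xc d M i) < dx d -> 0 < m * (y - yc d M j) < dy d ->
  value d U (other M) x y =
  U (other M) (other_index M i l) (other_index M j m) x y.
Proof.
  intros Hl Hm Hx Hy. unfold value.
  rewrite (Int_part_other_index _ _ _ _ _ _ (dx_pos d Hd) Hl Hx).
  rewrite (Int_part_other_index _ _ _ _ _ _ (dy_pos d Hd) Hm Hy).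
  reflexivity.
Qed.

(** One rule is used in each direction and on each quarter of the cell, so that
    functions with a different polynomial on each quarter are covered. *)
Lemma cell_integral_line_means M i j n node w n' node' w' f
    (P : R -> R -> R -> R -> R) :
  exact_to_degree (degK d) n node w -> exact_to_degree (degK d) n' node' w' ->
  (forall l m, l = -1 \/ l = 1 -> m = -1 \/ m = 1 -> is_poly2 (degK d) (P l m)) ->
  (forall l m x y, l = -1 \/ l = 1 -> m = -1 \/ m = 1 ->
    0 < l * (x - xc d M i) < dx d / 2 -> 0 < m * (y - yc d M j) < dy d / 2 ->
    f x y = P l m x y) ->
  cell_integral d M i j f =
  dx d * dy d * line_mean (xc d M i) (dx d) n node w (fun l x =>
    line_mean (yc d M j) (dy d) n' node' w' (fun m y => P l m x y)).
Proof.
  intros Hex Hex' HP Hf. unfold cell_integral.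
  pose proof (dx_pos d Hd). pose proof (dy_pos d Hd).
  rewrite (RInt_line_mean (degK d) n node w _ _ _ (fun l x =>
    dy d * line_mean (yc d M j) (dy d) n' node' w' (fun m y => P l m x y))).
  - rewrite line_mean_scal. ring.
  - assumption.
  - assumption.
  - intros l Hl. apply poly1_scal.
    apply (poly1_line_mean _ _ _ _ _ _ (fun x m y => P l m x y)).
    intros m y Hm. apply (poly2_slice_x _ (P l m)), HP; assumption.
  - intros l x Hl Hx. apply (RInt_line_mean (degK d)); try assumption.
    + intros m Hm. apply (poly2_slice_y _ (P l m)), HP; assumption.
    + intros m y Hm Hy. apply Hf; assumption.
Qed.

Definition cell_mean M i j (f : R -> R -> R) : R :=
  line_mean (xc d M i) (dx d) (numQ d) (gnode d) (gweight d) (fun _ x =>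
    line_mean (yc d M j) (dy d) (numQ d) (gnode d) (gweight d) (fun _ y => f x y)).

Lemma gauss_exact_degK : exact_to_degree (degK d) (numQ d) (gnode d) (gweight d).
Proof.
  eapply exact_to_degree_mono; [|apply (gauss_exact _ _ _ (gauss_ok d Hd))].
  pose proof (numQ_large d Hd). lia.
Qed.

Lemma lobatto_exact_degK : exact_to_degree (degK d) (numL d) (lnode d) (lweight d).
Proof.
  eapply exact_to_degree_mono; [|apply (lobatto_exact _ _ _ (lobatto_ok d Hd))].
  pose proof (numL_large d Hd). lia.
Qed.

Lemma cell_integral_poly M i j f :
  is_poly2 (degK d) f -> cell_integral d M i j f = dx d * dy d * cell_mean M i j f.
Proof.
  intros Hf.
  apply (cell_integral_line_means M i j _ _ _ _ _ _ f (fun _ _ => f));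
    try apply gauss_exact_degK; auto.
Qed.

Lemma cell_mean_linear M i j a b f g :
  cell_mean M i j (fun x y => a * f x y + b * g x y) =
  a * cell_mean M i j f + b * cell_mean M i j g.
Proof.
  unfold cell_mean. rewrite <- !line_mean_scal, <- line_mean_plus.
  apply line_mean_ext. intros l q _ _.
  now rewrite line_mean_plus, !line_mean_scal.
Qed.

Lemma cell_average_poly U M i j k : piecewise_poly d U ->
  cell_average d U M i j k = cell_mean M i j (fun x y => U M i j x y k).
Proof.
  intros HU. unfold cell_average. rewrite cell_integral_poly by apply HU.
  pose proof (dx_pos d Hd). pose proof (dy_pos d Hd). field. lra.
Qed.

(** ** Nodes *)

Lemma in_nodes_1d c len n node l a : l = -1 \/ l = 1 -> (1 <= a <= n)%nat ->
  In (half_node c len l (node a)) (nodes_1d c len n node).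
Proof.
  intros Hl Ha. unfold nodes_1d. apply in_or_app.
  destruct Hl as [->| ->]; [left|right].
  - apply (in_map (fun a => half_node c len (-1) (node a))), in_seq. lia.
  - apply (in_map (fun a => half_node c len 1 (node a))), in_seq. lia.
Qed.

Lemma in_points_gauss_gauss M i j l m a b :
  l = -1 \/ l = 1 -> m = -1 \/ m = 1 ->
  (1 <= a <= numQ d)%nat -> (1 <= b <= numQ d)%nat ->
  In (X M i l (gnode d a), Y M j m (gnode d b)) (points d M i j).
Proof.
  intros. unfold points. do 2 (apply in_or_app; right).
  apply in_prod; now apply in_nodes_1d.
Qed.

Lemma in_points_lobatto_gauss M i j l m a b :
  l = -1 \/ l = 1 -> m = -1 \/ m = 1 ->
  (1 <= a <= numL d)%nat -> (1 <= b <= numQ d)%nat ->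
  In (X M i l (lnode d a), Y M j m (gnode d b)) (points d M i j).
Proof.
  intros. unfold points. apply in_or_app; left.
  apply in_prod; now apply in_nodes_1d.
Qed.

Lemma in_points_gauss_lobatto M i j l m a b :
  l = -1 \/ l = 1 -> m = -1 \/ m = 1 ->
  (1 <= a <= numQ d)%nat -> (1 <= b <= numL d)%nat ->
  In (X M i l (gnode d a), Y M j m (lnode d b)) (points d M i j).
Proof.
  intros. unfold points. apply in_or_app; right. apply in_or_app; left.
  apply in_prod; now apply in_nodes_1d.
Qed.

Lemma gauss_half_node_inside c len l a : 0 < len -> l = -1 \/ l = 1 ->
  (1 <= a <= numQ d)%nat ->
  0 < l * (half_node c len l (gnode d a) - c) < len.
Proof.
  intros Hlen Hl Ha.
  pose proof (gauss_inside _ _ _ (gauss_ok d Hd) a Ha) as Hg.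
  unfold half_node. destruct Hl as [->| ->]; nra.
Qed.

Lemma end_inside c len s : 0 < len -> s = -1 \/ s = 1 ->
  0 < s * (c + s * (len / 2) - c) < len.
Proof. intros Hlen [->| ->]; lra. Qed.

Lemma cell_mean_in_cone U M i j :
  (forall x y, In (x, y) (points d M i j) -> open_cone (U x y)) ->
  open_cone (fun k => cell_mean M i j (fun x y => U x y k)).
Proof.
  intros HU. pose proof (numQ_large d Hd).
  apply (open_cone_line_mean _ _ _ _ _ (fun _ x k =>
    line_mean (yc d M j) (dy d) (numQ d) (gnode d) (gweight d) (fun _ y => U x y k)));
    [lia|apply (gauss_weight_pos _ _ _ (gauss_ok d Hd))|].
  intros l a Hl Ha.
  apply (open_cone_line_mean _ _ _ _ _ (fun _ y => U _ y));
    [lia|apply (gauss_weight_pos _ _ _ (gauss_ok d Hd))|].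
  intros m b Hm Hb. now apply HU, in_points_gauss_gauss.
Qed.

(** * Forward Euler steps *)

(** On one line across a cell, the mean value of the other mesh's solution pays
    for the fluxes through both end points: the two end nodes of the
    Gauss-Lobatto rule are exactly those end points, and a share [lambda] of
    their weight is enough for Lax-Friedrichs splitting. The remaining nodes
    keep the sum in the open cone. *)
Lemma line_with_fluxes_in_cone c len (A lambda : R) (Z F : R -> R -> state) :
  (2 <= numL d)%nat -> 0 < A -> 0 < lambda -> 2 * lambda <= A * lweight d 1 ->
  (forall l a, l = -1 \/ l = 1 -> (1 <= a <= numL d)%nat ->
    open_cone (Z l (half_node c len l (lnode d a)))) ->
  (forall s, s = -1 \/ s = 1 ->
    closed_cone (fun k => Z s (c + s * (len / 2)) k
                          - s * F s (c + s * (len / 2)) k)) ->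
  open_cone (fun k =>
    A * line_mean c len (numL d) (lnode d) (lweight d) (fun l x => Z l x k)
    - lambda * sum_pm (fun s => s * F s (c + s * (len / 2)) k)).
Proof.
  intros HL HA Hlam Hcfl HZ HF.
  pose proof (lobatto_ok d Hd) as HR.
  pose proof (lobatto_weight_pos _ _ _ HR) as Hw.
  pose proof (lobatto_end_weights _ _ _ HL HR) as Hends.
  pose proof (lobatto_first _ _ _ HR) as H1.
  pose proof (lobatto_last _ _ _ HR) as H2.
  set (Zn := fun l a => Z l (half_node c len l (lnode d a))).
  (* The contribution of one half: inner nodes, the rest of the end node, and
     the end node minus its flux. *)
  set (half := fun s p q => state_add
    (state_scale (A / 2) (fun k =>
       sum_n_m (fun a => lweight d a * Zn s a k) p q))
    (state_add
      (state_scale (A / 2 * lweight d 1 - lambda) (Z s (c + s * (len / 2))))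
      (state_scale lambda (fun k => Z s (c + s * (len / 2)) k
                          - s * F s (c + s * (len / 2)) k)))).
  assert (Hhalf : forall s p q, s = -1 \/ s = 1 -> (1 <= p <= q)%nat ->
            (q <= numL d)%nat -> open_cone (Z s (c + s * (len / 2))) ->
            open_cone (half s p q)).
  { intros s p q Hs Hp Hq Hend. unfold half. apply open_cone_add.
    - apply open_cone_scale; [lra|].
      apply (open_cone_sum (fun a => state_scale (lweight d a) (Zn s a))); [lia|].
      intros a Ha. apply open_cone_scale; [apply Hw; lia|]. apply HZ; [exact Hs|lia].
    - apply closed_cone_add; apply closed_cone_scale; try lra.
      + now apply open_cone_closed.
      + now apply HF. }
  assert (E1 : half_node c len (-1) (lnode d 1) = c + -1 * (len / 2)).
  { rewrite H1. unfold half_node. field. }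
  assert (E2 : half_node c len 1 (lnode d (numL d)) = c + 1 * (len / 2)).
  { rewrite H2. unfold half_node. field. }
  apply (open_cone_ext (state_add (half (-1) 2%nat (numL d))
                                  (half 1 1%nat (numL d - 1)%nat))).
  - intros k. unfold half, state_add, state_scale, line_mean, sum_pm.
    rewrite (sum_n_m_Rext
      (fun a => lweight d a * (Z (-1) (half_node c len (-1) (lnode d a)) k
                               + Z 1 (half_node c len 1 (lnode d a)) k))
      (fun a => lweight d a * Zn (-1) a k + lweight d a * Zn 1 a k))
      by (intros a _; unfold Zn; ring).
    rewrite sum_n_m_Rplus.
    rewrite (sum_n_m_Rfirst (fun a => lweight d a * Zn (-1) a k) 1) by lia.
    replace (sum_n_m (fun a => lweight d a * Zn 1 a k) 1 (numL d))
      with (sum_n_m (fun a => lweight d a * Zn 1 a k) 1 (numL d - 1)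
            + lweight d (numL d) * Zn 1 (numL d) k).
    2:{ replace (numL d) with (S (numL d - 1)) at 2 3 4 by lia.
        symmetry. apply sum_n_m_Rlast. lia. }
    replace (Zn (-1) 1%nat) with (Z (-1) (c + -1 * (len / 2)))
      by (unfold Zn; now rewrite E1).
    replace (Zn 1 (numL d)) with (Z 1 (c + 1 * (len / 2)))
      by (unfold Zn; now rewrite E2).
    rewrite Hends. field.
  - apply open_cone_add; [|apply open_cone_closed]; apply Hhalf; auto; try lia.
    + rewrite <- E1. apply HZ; [auto|lia].
    + rewrite <- E2. apply HZ; [auto|lia].
Qed.

Variable e : R -> R -> R.
Hypothesis He : eos_assumptions e.

(** Testing the scheme with the constant 1 turns it into an evolution equation
    for the averages. Its right-hand side is reorganised into one term
    [Tx] for each horizontal line of Gauss nodes, one term [Ty] for each vertical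
    line, each in the cone by [line_with_fluxes_in_cone], and the remaining
    [1 - theta] times the old average. *)
Theorem euler_step_in_cone (V LV : field) (h : R) M i j :
  (1 <= degK d)%nat ->
  piecewise_poly d V -> is_L e d V LV ->
  (forall M i j x y, In (x, y) (points d M i j) -> open_cone (V M i j x y)) ->
  0 < h ->
  h / dx d + h / dy d <= lweight d 1 * (h / tau_max d) / 2 ->
  h / tau_max d <= 1 ->
  open_cone (fun k => cell_mean M i j (fun x y => V M i j x y k)
                      + h * cell_mean M i j (fun x y => LV M i j x y k)).
Proof.
  intros HK HV [HLV HL] Hcone Hh Hcfl Htheta.
  pose proof (dx_pos d Hd) as Hdx. pose proof (dy_pos d Hd) as Hdy.
  pose proof (tau_max_pos d Hd) as Htau.
  pose proof (numL_large d Hd) as HnL. pose proof (numQ_large d Hd) as HnQ.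
  set (P := fun l m => V (other M) (other_index M i l) (other_index M j m)).
  set (Uo := value d V (other M)) in *.
  set (lx := h / dx d) in *. set (ly := h / dy d) in *.
  set (theta := h / tau_max d) in *.
  assert (Hlx : 0 < lx) by (apply Rdiv_lt_0_compat; assumption).
  assert (Hly : 0 < ly) by (apply Rdiv_lt_0_compat; assumption).
  assert (Hth : 0 < theta) by (apply Rdiv_lt_0_compat; assumption).
  assert (HPpoly : forall k l m, is_poly2 (degK d) (fun x y => P l m x y k))
    by (intros; apply HV).
  assert (HPval : forall l m x y, l = -1 \/ l = 1 -> m = -1 \/ m = 1 ->
            0 < l * (x - xc d M i) < dx d -> 0 < m * (y - yc d M j) < dy d ->
            Uo x y = P l m x y) by (intros; apply value_other; assumption).
  set (gx := line_mean (xc d M i) (dx d) (numQ d) (gnode d) (gweight d)).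
  set (gy := line_mean (yc d M j) (dy d) (numQ d) (gnode d) (gweight d)).
  set (hx := line_mean (xc d M i) (dx d) (numL d) (lnode d) (lweight d)).
  set (hy := line_mean (yc d M j) (dy d) (numL d) (lnode d) (lweight d)).
  set (Xe := fun s => xc d M i + s * (dx d / 2)).
  set (Ye := fun s => yc d M j + s * (dy d / 2)).
  (* The shares of the other mesh's average given to the two directions are
     proportional to [h / dx] and [h / dy]. *)
  set (Ax := theta * (lx / (lx + ly))). set (Ay := theta * (ly / (lx + ly))).
  set (Tx := fun m y k => Ax * hx (fun l x => P l m x y k)
      - lx * sum_pm (fun s => s * flux1 e (P s m (Xe s) y) k)).
  set (Ty := fun l x k => Ay * hy (fun m y => P l m x y k)
      - ly * sum_pm (fun s => s * flux2 e (P l s x (Ye s)) k)).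
  assert (HTx : forall m b, m = -1 \/ m = 1 -> (1 <= b <= numQ d)%nat ->
            open_cone (Tx m (Y M j m (gnode d b)))).
  { intros m b Hm Hb.
    assert (HZ : forall l a, l = -1 \/ l = 1 -> (1 <= a <= numL d)%nat ->
              open_cone (P l m (X M i l (lnode d a)) (Y M j m (gnode d b)))).
    { intros l a Hl Ha. apply Hcone.
      rewrite <- (half_node_other_x M i l) by exact Hl.
      rewrite <- (half_node_other_y M j m) by exact Hm.
      apply in_points_lobatto_gauss; try assumption; lra. }
    apply (line_with_fluxes_in_cone _ _ _ _
             (fun l x => P l m x (Y M j m (gnode d b)))
             (fun l x => flux1 e (P l m x (Y M j m (gnode d b)))));
      try assumption; try lia.
    - apply Rmult_lt_0_compat; [lra|]. apply Rdiv_lt_0_compat; lra.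
    - unfold Ax. apply (Rmult_le_reg_r ((lx + ly) / lx)).
      + apply Rdiv_lt_0_compat; lra.
      + replace (2 * lx * ((lx + ly) / lx)) with (2 * (lx + ly)) by (field; lra).
        replace (theta * (lx / (lx + ly)) * lweight d 1 * ((lx + ly) / lx))
          with (theta * lweight d 1) by (field; lra). lra.
    - intros s Hs. apply (lax_friedrichs1 e He); [|exact Hs].
      apply (admissible_iff_cone e He).
      destruct Hs as [->| ->].
      + replace (xc d M i + -1 * (dx d / 2)) with (X M i (-1) (lnode d 1)).
        * apply HZ; [auto|lia].
        * rewrite (lobatto_first _ _ _ (lobatto_ok d Hd)). unfold X, half_node. field.
      + replace (xc d M i + 1 * (dx d / 2)) with (X M i 1 (lnode d (numL d))).
        * apply HZ; [auto|lia].
        * rewrite (lobatto_last _ _ _ (lobatto_ok d Hd)). unfold X, half_node. field. }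
  assert (HTy : forall l a, l = -1 \/ l = 1 -> (1 <= a <= numQ d)%nat ->
            open_cone (Ty l (X M i l (gnode d a)))).
  { intros l a Hl Ha.
    assert (HZ : forall m b, m = -1 \/ m = 1 -> (1 <= b <= numL d)%nat ->
              open_cone (P l m (X M i l (gnode d a)) (Y M j m (lnode d b)))).
    { intros m b Hm Hb. apply Hcone.
      rewrite <- (half_node_other_x M i l) by exact Hl.
      rewrite <- (half_node_other_y M j m) by exact Hm.
      apply in_points_gauss_lobatto; try assumption; lra. }
    apply (line_with_fluxes_in_cone _ _ _ _
             (fun m y => P l m (X M i l (gnode d a)) y)
             (fun m y => flux2 e (P l m (X M i l (gnode d a)) y)));
      try assumption; try lia.
    - apply Rmult_lt_0_compat; [lra|]. apply Rdiv_lt_0_compat; lra.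
    - unfold Ay. apply (Rmult_le_reg_r ((lx + ly) / ly)).
      + apply Rdiv_lt_0_compat; lra.
      + replace (2 * ly * ((lx + ly) / ly)) with (2 * (lx + ly)) by (field; lra).
        replace (theta * (ly / (lx + ly)) * lweight d 1 * ((lx + ly) / ly))
          with (theta * lweight d 1) by (field; lra). lra.
    - intros s Hs. apply (lax_friedrichs2 e He); [|exact Hs].
      apply (admissible_iff_cone e He).
      destruct Hs as [->| ->].
      + replace (yc d M j + -1 * (dy d / 2)) with (Y M j (-1) (lnode d 1)).
        * apply HZ; [auto|lia].
        * rewrite (lobatto_first _ _ _ (lobatto_ok d Hd)). unfold Y, half_node. field.
      + replace (yc d M j + 1 * (dy d / 2)) with (Y M j 1 (lnode d (numL d))).
        * apply HZ; [auto|lia].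
        * rewrite (lobatto_last _ _ _ (lobatto_ok d Hd)). unfold Y, half_node. field. }
  apply (open_cone_ext (state_add (state_add
    (fun k => gy (fun m y => Tx m y k)) (fun k => gx (fun l x => Ty l x k)))
    (state_scale (1 - theta)
      (fun k => cell_mean M i j (fun x y => V M i j x y k))))).
  2:{ apply open_cone_add.
      - apply open_cone_add; [|apply open_cone_closed];
          apply open_cone_line_mean; try lia;
          try (apply (gauss_weight_pos _ _ _ (gauss_ok d Hd))); assumption.
      - apply closed_cone_scale; [lra|].
        apply open_cone_closed, cell_mean_in_cone, Hcone. }
  intros k. unfold state_add, state_scale.
  pose proof (HL M i j (fun _ _ => 1) k (poly2_const _ 1)) as Hw.
  cbv beta zeta in Hw. fold Uo in Hw.
  set (FX := sum_n_m (fun b => gweight d b * sum_pm (fun m => sum_pm (fun s =>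
               s * flux1 e (P s m (Xe s) (Y M j m (gnode d b))) k))) 1 (numQ d)).
  set (FY := sum_n_m (fun a => gweight d a * sum_pm (fun l => sum_pm (fun s =>
               s * flux2 e (P l s (X M i l (gnode d a)) (Ye s)) k))) 1 (numQ d)).
  match type of Hw with _ = _ + dx d * dy d / 4 * ?S0 - _ * ?S1 - _ * ?S2 =>
    assert (K0 : S0 = 0); [|assert (K1 : S1 = FX); [|assert (K2 : S2 = FY)]]
  end.
  { rewrite <- (sum_n_m_R0 1 (numQ d)). apply sum_n_m_Rext. intros a _.
    rewrite <- (sum_n_m_R0 1 (numQ d)). apply sum_n_m_Rext. intros b _.
    unfold sum_pm. rewrite !Derive_const. ring. }
  { apply sum_n_m_Rext. intros b Hb.
    assert (Hval : forall s m, s = -1 \/ s = 1 -> m = -1 \/ m = 1 ->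
      Uo (xc d M i + s * (dx d / 2)) (half_node (yc d M j) (dy d) m (gnode d b))
      = P s m (Xe s) (Y M j m (gnode d b))).
    { intros s m Hs Hm. apply HPval; try assumption.
      - now apply end_inside.
      - apply gauss_half_node_inside; assumption. }
    unfold sum_pm. rewrite !Hval by auto. ring. }
  { apply sum_n_m_Rext. intros a Ha.
    assert (Hval : forall l s, l = -1 \/ l = 1 -> s = -1 \/ s = 1 ->
      Uo (half_node (xc d M i) (dx d) l (gnode d a)) (yc d M j + s * (dy d / 2))
      = P l s (X M i l (gnode d a)) (Ye s)).
    { intros l s Hl Hs. apply HPval; try assumption.
      - apply gauss_half_node_inside; assumption.
      - now apply end_inside. }
    unfold sum_pm. rewrite !Hval by auto. ring. }
  rewrite K0, K1, K2 in Hw. clear K0 K1 K2.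
  set (mV := cell_mean M i j (fun x y => V M i j x y k)).
  set (mL := cell_mean M i j (fun x y => LV M i j x y k)).
  assert (HmL : cell_integral d M i j (fun x y => LV M i j x y k * 1)
                = dx d * dy d * mL).
  { rewrite cell_integral_poly.
    - f_equal. unfold mL, cell_mean. apply line_mean_ext. intros.
      apply line_mean_ext. intros. ring.
    - apply (poly2_ext _ (fun x y => LV M i j x y k)); [intros; ring|apply HLV]. }
  assert (Hcross : forall n node w n' node' w',
    exact_to_degree (degK d) n node w -> exact_to_degree (degK d) n' node' w' ->
    cell_integral d M i j (fun x y => (Uo x y k - V M i j x y k) * 1) =
    dx d * dy d * (line_mean (xc d M i) (dx d) n node w (fun l x =>
       line_mean (yc d M j) (dy d) n' node' w' (fun m y => P l m x y k)) - mV)).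
  { intros n node w n' node' w' Hex Hex'.
    assert (HmV : mV = line_mean (xc d M i) (dx d) n node w (fun l x =>
       line_mean (yc d M j) (dy d) n' node' w' (fun m y => V M i j x y k))).
    { apply (Rmult_eq_reg_l (dx d * dy d)); [|nra].
      unfold mV. rewrite <- cell_integral_poly by apply HV.
      now apply (cell_integral_line_means M i j n node w n' node' w' _
                   (fun _ _ x y => V M i j x y k)). }
    rewrite (cell_integral_line_means M i j n node w n' node' w' _
               (fun l m x y => P l m x y k + -1 * V M i j x y k)); try assumption.
    - f_equal. unfold Rminus. rewrite HmV.
      replace (- line_mean (xc d M i) (dx d) n node w (fun l x =>
         line_mean (yc d M j) (dy d) n' node' w' (fun m y => V M i j x y k)))
        with (-1 * line_mean (xc d M i) (dx d) n node w (fun l x =>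
         line_mean (yc d M j) (dy d) n' node' w' (fun m y => V M i j x y k))) by ring.
      rewrite <- line_mean_scal, <- line_mean_plus.
      apply line_mean_ext. intros l a _ _.
      now rewrite line_mean_plus, line_mean_scal.
    - intros l m _ _. apply poly2_plus; [apply HPpoly|apply poly2_scal, HV].
    - intros l m x y Hl Hm Hx Hy.
      rewrite (HPval l m) by (assumption || lra). ring. }
  set (cross := hx (fun l x => gy (fun m y => P l m x y k))).
  pose proof (Hcross _ _ _ _ _ _ lobatto_exact_degK gauss_exact_degK) as C1.
  pose proof (Hcross _ _ _ _ _ _ gauss_exact_degK lobatto_exact_degK) as C2.
  fold gx gy hx hy in C1, C2. fold cross in C1.
  assert (Hsame : gx (fun l x => hy (fun m y => P l m x y k)) = cross).
  { rewrite C1 in C2. apply Rmult_eq_reg_l in C2; [lra|nra]. }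
  assert (Sx : gy (fun m y => Tx m y k) = Ax * cross - lx / 2 * FX).
  { transitivity (gy (fun m y => Ax * hx (fun l x => P l m x y k)
      + - lx * sum_pm (fun s => s * flux1 e (P s m (Xe s) y) k))).
    - apply line_mean_ext. intros. unfold Tx. ring.
    - unfold gy. rewrite line_mean_plus, !line_mean_scal. unfold hx.
      rewrite <- line_mean_exchange. fold gy hx cross.
      replace (gy (fun m y => sum_pm (fun s => s * flux1 e (P s m (Xe s) y) k)))
        with (1 / 2 * FX) by reflexivity. field. }
  assert (Sy : gx (fun l x => Ty l x k) = Ay * cross - ly / 2 * FY).
  { transitivity (gx (fun l x => Ay * hy (fun m y => P l m x y k)
      + - ly * sum_pm (fun s => s * flux2 e (P l s x (Ye s)) k))).
    - apply line_mean_ext. intros. unfold Ty. ring.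
    - unfold gx. rewrite line_mean_plus, !line_mean_scal. fold gx.
      rewrite Hsame.
      replace (gx (fun l x => sum_pm (fun s => s * flux2 e (P l s x (Ye s)) k)))
        with (1 / 2 * FY) by reflexivity. field. }
  rewrite Sx, Sy, HmL in *. rewrite C1 in Hw.
  assert (HmL' : h * mL = theta * (cross - mV) - lx / 2 * FX - ly / 2 * FY).
  { apply (Rmult_eq_reg_l (dx d * dy d)); [|nra].
    replace (dx d * dy d * (h * mL)) with (h * (dx d * dy d * mL)) by ring.
    rewrite Hw. unfold theta, lx, ly. field. lra. }
  rewrite HmL'. unfold Ax, Ay. field. lra.
Qed.

End Averages.

(** * Fully discrete schemes *)

Section Schemes.

Variable e : R -> R -> R.
Hypothesis He : eos_assumptions e.
Variable d : discretization.
Hypothesis Hd : discretization_ok d.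
Hypothesis HK : (1 <= degK d)%nat.

Lemma limited_poly eps U : piecewise_poly d U -> piecewise_poly d (limited d eps U).
Proof. intros HU M i j. apply limit_poly. intros k. apply HU. Qed.

Lemma limited_in_cone eps U : eps_ok e d eps U -> averages_admissible e d U ->
  forall M i j x y, In (x, y) (points d M i j) ->
    open_cone (limited d eps U M i j x y).
Proof.
  intros Heps HU M i j x y HS.
  destruct (Heps M i j) as [Hpos Hle].
  destruct (Hle (HU M i j)) as [HD Hq].
  now apply limiter_in_cone.
Qed.

Lemma limited_admissible_of_averages eps U :
  eps_ok e d eps U -> averages_admissible e d U -> limited_admissible e d eps U.
Proof.
  intros Heps HU M i j x y HS. apply (admissible_iff_cone e He).
  now apply limited_in_cone.
Qed.

Definition poly_with_good_averages (U : field) : Prop :=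
  piecewise_poly d U /\ averages_admissible e d U.

(** The length 0 is included so that a limited solution is itself the result of
    an Euler step, and the schemes only combine Euler steps. *)
Definition euler_cfl (h : R) : Prop :=
  0 <= h /\ h / dx d + h / dy d <= lweight d 1 * (h / tau_max d) / 2 /\
  h / tau_max d <= 1.

(** The bound on the step relative to the mesh is homogeneous in the length,
    so only the bound on [theta] restricts the multiples. *)
Lemma euler_cfl_scale c h :
  0 <= c -> 0 <= h ->
  h / dx d + h / dy d <= lweight d 1 * (h / tau_max d) / 2 ->
  c * (h / tau_max d) <= 1 -> euler_cfl (c * h).
Proof.
  intros Hc Hh Hcfl Hth. unfold euler_cfl, Rdiv in *. split; [|split].
  - now apply Rmult_le_pos.
  - apply (Rmult_le_compat_l c) in Hcfl; [|exact Hc]. lra.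
  - lra.
Qed.

Lemma euler_step_of_limited_in_cone eps U LV h M i j :
  poly_with_good_averages U -> eps_ok e d eps U ->
  is_L e d (limited d eps U) LV -> euler_cfl h ->
  open_cone (fun k => cell_mean d M i j (fun x y => limited d eps U M i j x y k)
                      + h * cell_mean d M i j (fun x y => LV M i j x y k)).
Proof.
  intros [PU AU] Heps HL [[Hh|<-] [Hcfl Hth]].
  - apply (euler_step_in_cone d Hd e He); try assumption.
    + now apply limited_poly.
    + now apply limited_in_cone.
  - apply (open_cone_ext (fun k =>
      cell_mean d M i j (fun x y => limited d eps U M i j x y k))).
    + intros k. ring.
    + apply (cell_mean_in_cone d Hd (fun x y => limited d eps U M i j x y)).
      now apply limited_in_cone.
Qed.

(** Convexity transfers admissibility from Euler steps to their combinations,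
    because cell averages are linear; both time discretizations only need
    combinations of two steps. *)
Lemma convex_combination_good eps eps' U U' LV LV' b b' h h' Unew :
  poly_with_good_averages U -> poly_with_good_averages U' ->
  eps_ok e d eps U -> eps_ok e d eps' U' ->
  is_L e d (limited d eps U) LV -> is_L e d (limited d eps' U') LV' ->
  0 <= b -> 0 < b' -> euler_cfl h -> euler_cfl h' ->
  (forall M i j x y k, Unew M i j x y k =
     b * (limited d eps U M i j x y k + h * LV M i j x y k)
     + b' * (limited d eps' U' M i j x y k + h' * LV' M i j x y k)) ->
  poly_with_good_averages Unew.
Proof.
  intros GU GU' Heps Heps' HL HL' Hb Hb' Hh Hh' Hnew.
  pose proof (limited_poly eps U (proj1 GU)) as PV.
  pose proof (limited_poly eps' U' (proj1 GU')) as PV'.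
  assert (Pnew : piecewise_poly d Unew).
  { intros M i j k. eapply poly2_ext; [intros; symmetry; apply Hnew|].
    apply poly2_plus; apply poly2_scal; apply poly2_plus;
      try apply PV; try apply PV'; apply poly2_scal; [apply HL|apply HL']. }
  split; [exact Pnew|]. intros M i j. apply (admissible_iff_cone e He).
  pose proof (euler_step_of_limited_in_cone eps U LV h M i j GU Heps HL Hh) as S1.
  pose proof (euler_step_of_limited_in_cone eps' U' LV' h' M i j GU' Heps' HL' Hh')
    as S2.
  pose proof (open_cone_add _ _ (open_cone_scale b' _ Hb' S2)
    (closed_cone_scale b _ Hb (open_cone_closed _ S1))) as S.
  revert S. apply open_cone_ext.
  intros k. rewrite (cell_average_poly d Hd) by exact Pnew.
  unfold state_add, state_scale.
  transitivity (cell_mean d M i j (fun x y =>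
    b * (1 * limited d eps U M i j x y k + h * LV M i j x y k)
    + b' * (1 * limited d eps' U' M i j x y k + h' * LV' M i j x y k))).
  - rewrite !cell_mean_linear. ring.
  - unfold cell_mean. apply line_mean_ext. intros. apply line_mean_ext. intros.
    rewrite Hnew. ring.
Qed.

Lemma RK_step_good dt U U1 U2 eps eps1 eps2 n :
  euler_cfl 0 -> euler_cfl dt ->
  RK_solution e d dt U U1 U2 eps eps1 eps2 -> poly_with_good_averages (U n) ->
  poly_with_good_averages (U1 n) /\ poly_with_good_averages (U2 n) /\
  poly_with_good_averages (U (S n)).
Proof.
  intros C0 C1 Hsol G.
  pose proof (RK_eps _ _ _ _ _ _ _ _ _ Hsol n) as E0.
  pose proof (RK_eps1 _ _ _ _ _ _ _ _ _ Hsol n) as E1.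
  pose proof (RK_eps2 _ _ _ _ _ _ _ _ _ Hsol n) as E2.
  destruct (RK_step _ _ _ _ _ _ _ _ _ Hsol n)
    as [LV [LV1 [LV2 [L0 [L1 [L2 Hstep]]]]]].
  assert (G1 : poly_with_good_averages (U1 n)).
  { apply (convex_combination_good (eps n) (eps n) (U n) (U n) LV LV 0 1 0 dt);
      try assumption; try lra.
    intros M i j x y k. rewrite (proj1 (Hstep M i j x y k)). ring. }
  assert (G2 : poly_with_good_averages (U2 n)).
  { apply (convex_combination_good (eps n) (eps1 n) (U n) (U1 n) LV LV1
             (3 / 4) (1 / 4) 0 dt); try assumption; try lra.
    intros M i j x y k. rewrite (proj1 (proj2 (Hstep M i j x y k))). ring. }
  split; [exact G1|split; [exact G2|]].
  apply (convex_combination_good (eps n) (eps2 n) (U n) (U2 n) LV LV2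
           (1 / 3) (2 / 3) 0 dt); try assumption; try lra.
  intros M i j x y k. rewrite (proj2 (proj2 (Hstep M i j x y k))). ring.
Qed.

Lemma MS_step_good dt U eps n :
  euler_cfl (3 * dt) -> euler_cfl (12 / 11 * dt) ->
  MS_solution e d dt U eps -> (3 <= n)%nat ->
  poly_with_good_averages (U n) -> poly_with_good_averages (U (n - 3)%nat) ->
  poly_with_good_averages (U (S n)).
Proof.
  intros C C3 Hsol Hn G G3.
  destruct (MS_step _ _ _ _ _ Hsol n Hn) as [LV [LV3 [L [L3 Hstep]]]].
  apply (convex_combination_good (eps n) (eps (n - 3)%nat) (U n) (U (n - 3)%nat)
           LV LV3 (16 / 27) (11 / 27) (3 * dt) (12 / 11 * dt));
    try assumption; try lra; try apply (MS_eps _ _ _ _ _ Hsol).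
Qed.

End Schemes.

Theorem theorem4p7 (e : R -> R -> R) (d : discretization) (dt : R)
    (He : eos_assumptions e) (Hd : discretization_ok d)
    (HK : (1 <= degK d)%nat) :
  let theta := dt / tau_max d in
  (0 < dt / dx d + dt / dy d <= lweight d 1 * theta / 2 ->
   0 < theta <= 1 ->
   RK_PCP e d dt) /\
  (0 < dt / dx d + dt / dy d <= lweight d 1 * theta / 2 ->
   0 < theta <= 1 / 3 ->
   MS_PCP e d dt).
Proof.
  intros theta.
  assert (Hdt : 0 < theta -> 0 <= dt).
  { intros H. pose proof (tau_max_pos d Hd).
    replace dt with (theta * tau_max d) by (unfold theta; field; lra).
    apply Rmult_le_pos; lra. }
  assert (cfl : forall c, dt / dx d + dt / dy d <= lweight d 1 * theta / 2 ->
            0 < theta -> 0 <= c -> c * theta <= 1 -> euler_cfl d (c * dt)).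
  { intros c Hcfl Hth Hc Hcth. apply euler_cfl_scale; auto. }
  split; intros [_ Hcfl] [Hth Hth1].
  - intros U U1 U2 eps eps1 eps2 Hsol H0.
    assert (C0 : euler_cfl d 0).
    { replace 0 with (0 * dt) by ring. apply cfl; lra. }
    assert (C1 : euler_cfl d dt).
    { replace dt with (1 * dt) by ring. apply cfl; lra. }
    assert (G : forall n, poly_with_good_averages e d (U n)).
    { induction n as [|n IH].
      - split; [apply (RK_start _ _ _ _ _ _ _ _ _ Hsol)|exact H0].
      - now apply (RK_step_good e He d Hd HK dt U U1 U2 eps eps1 eps2). }
    intros n.
    destruct (RK_step_good e He d Hd HK dt U U1 U2 eps eps1 eps2 n C0 C1 Hsol (G n))
      as [G1 [G2 _]].
    pose proof (proj2 (G n)). pose proof (proj2 G1). pose proof (proj2 G2).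
    repeat split; try assumption;
      apply (limited_admissible_of_averages e He); try assumption; apply Hsol.
  - intros U eps Hsol H0.
    assert (G : forall n m, (m <= n)%nat -> poly_with_good_averages e d (U m)).
    { assert (start : forall m, (m <= 3)%nat -> poly_with_good_averages e d (U m)).
      { intros m Hm.
        split; [now apply (MS_start _ _ _ _ _ Hsol)|now apply H0]. }
      induction n as [|n IH]; intros m Hm; [apply start; lia|].
      destruct (Nat.le_gt_cases m 3) as [H3|H3]; [now apply start|].
      destruct (Nat.eq_dec m (S n)) as [->|Hne]; [|apply IH; lia].
      apply (MS_step_good e He d Hd HK dt U eps n); try assumption; try lia;
        try (apply IH; lia); apply cfl; lra. }
    intros n. pose proof (G n n (le_n n)) as [_ A].
    split; [exact A|].
    apply (limited_admissible_of_averages e He); [apply Hsol|exact A].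
Qed.
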